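(* Let $k>0$ and $A>0$, and let $f$ be a multiplicative function with $|f|\le\tau_k$ and $$\sum_{p\le x}f(p)\log p\ll\frac{x}{(\log x)^A}\qquad(x\ge2),$$ the sum being over primes. Then for $x\ge2$, $$\sum_{n\le x}f(n)\ll x(\log x)^{k-1-A},$$ where the implied constant depends at most on $k$, $A$ and the implicit constant in the hypothesis.
   Context: $\tau_k$ is the multiplicative function with $\sum_n\tau_k(n)n^{-s}=\zeta(s)^k$, i.e. $\tau_k(p^\nu)=\binom{k+\nu-1}{\nu}$. *)

(* Defs.v *)
From Stdlib Require Import Reals Lra Lia Arith List ZArith Znumtheory.
Import ListNotations.
Open Scope R_scope.

Definition Cx : Type := (R * R)%type.
Definition Cx0 : Cx := (0, 0).
Definition Cx1 : Cx := (1, 0).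
Definition Cxadd (z w : Cx) : Cx := (fst z + fst w, snd z + snd w).
Definition Cxmul (z w : Cx) : Cx :=
  (fst z * fst w - snd z * snd w, fst z * snd w + snd z * fst w).
Definition Cxscale (r : R) (z : Cx) : Cx := (r * fst z, r * snd z).
Definition Cxnorm (z : Cx) : R := sqrt (fst z ^ 2 + snd z ^ 2).
Definition Cxsum (l : list Cx) : Cx := fold_right Cxadd Cx0 l.

Definition is_primeb (p : nat) : bool :=
  if prime_dec (Z.of_nat p) then true else false.

(* p-adic valuation of n (for p >= 2, n >= 1); fuel n suffices *)
Fixpoint val_aux (fuel p n : nat) : nat :=
  match fuel with
  | O => O
  | S f => if ((1 <? p)%nat && (0 <? n)%nat && (n mod p =? 0)%nat)%bool
           then S (val_aux f p (n / p)) else O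
  end.
Definition pval (p n : nat) : nat := val_aux n p n.

Definition gbinom (a : R) (m : nat) : R :=
  fold_right Rmult 1 (map (fun i => (a - INR i) / (INR i + 1)) (seq 0 m)).

Definition tau (k : R) (n : nat) : R :=
  fold_right Rmult 1
    (map (fun p => if is_primeb p then gbinom (k + INR (pval p n) - 1) (pval p n) else 1)
         (seq 1 n)).

Definition multiplicative (f : nat -> Cx) : Prop :=
  f 1%nat = Cx1 /\
  forall m n : nat, (0 < m)%nat -> (0 < n)%nat -> Nat.gcd m n = 1%nat ->
    f (m * n)%nat = Cxmul (f m) (f n).

Definition floorN (x : R) : nat := Z.to_nat (Int_part x).

Definition sum_le (f : nat -> Cx) (x : R) : Cx :=
  Cxsum (map f (seq 1 (floorN x))).

Definition prime_sum_log (f : nat -> Cx) (x : R) : Cx :=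
  Cxsum (map (fun p => if is_primeb p then Cxscale (ln (INR p)) (f p) else Cx0)
             (seq 1 (floorN x))).

(* Main.v *)
(** Let [S_D(N)] be the sum of [f(n)] over [n <= N] divisible by no prime of the finite
    list [D], and [b = k - 1 - A].  One shows, by strong induction on [N] and for all [D]
    at once, that [|S_D(N)| <= K 2^|D| N (1 + log N)^b] with [K] depending only on [k],
    [A] and the constant of the hypothesis.  Writing [log n] as the sum of
    [v_p(n) log p] gives
      [log N * S_D(N) = sum_(n <= N) f(n) log(N/n)
         + sum_(p notin D) log p sum_v v f(p^v) S_(D+p)(N/p^v)],
    the first sum ranging over the same [n] as [S_D(N)].  By induction the first sum and
    the terms with [v >= 2] are [O(K N (log N)^b)], a logarithm less than what is needed,
    so their constant is harmless.  For [v = 1] and [p <= Y = N^(1/r)] induction gives at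
    most a constant times [K N (log N)^b log Y], which is a small multiple of the target
    if [r] is large.  For [p > Y] one sums over [p] first: the hypothesis on primes,
    together with [sum_(m <= N) tau_k(m)/m << (log N)^k], gives
    [O_r(N (log N)^(b+1))], with no factor [K].  Keeping track of [D] is what avoids
    inverting the Euler factors of [f] at small primes, which may vanish. *)
Require Import Defs.
From Stdlib Require Import Reals Lra.
From HB Require Import structures.
From mathcomp Require ssreflect ssrfun ssrbool eqtype ssrnat seq div prime bigop.
From mathcomp Require zify.
From Coquelicot Require Coquelicot.
Open Scope R_scope.

Module PartialSums.

Import ssreflect ssrfun ssrbool eqtype ssrnat seq div prime bigop zify.
Import Coquelicot.
Local Open Scope R_scope.
Set Implicit Arguments.
Unset Strict Implicit.
Unset Printing Implicit Defensive.
Local Arguments INR : simpl never.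

(** * Finite sums and products of real and complex numbers *)

HB.instance Definition _ := Monoid.isComLaw.Build R 0 Rplus
  (fun a b c => esym (Rplus_assoc a b c)) Rplus_comm Rplus_0_l.
HB.instance Definition _ := Monoid.isComLaw.Build R 1 Rmult
  (fun a b c => esym (Rmult_assoc a b c)) Rmult_comm Rmult_1_l.
HB.instance Definition _ := Monoid.isMulLaw.Build R 0 Rmult Rmult_0_l Rmult_0_r.
HB.instance Definition _ :=
  Monoid.isAddLaw.Build R Rmult Rplus Rmult_plus_distr_r Rmult_plus_distr_l.
HB.instance Definition _ := Monoid.isComLaw.Build C (RtoC 0) Cplus
  Cplus_assoc Cplus_comm Cplus_0_l.
HB.instance Definition _ := Monoid.isMulLaw.Build C (RtoC 0) Cmult Cmult_0_l Cmult_0_r.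
HB.instance Definition _ :=
  Monoid.isAddLaw.Build C Cmult Cplus Cmult_plus_distr_r Cmult_plus_distr_l.

Local Notation "\sum_ ( m <= i < n | P ) F" :=
  (\big[Rplus/0%R]_(m <= i < n | P%B) F%R) : R_scope.
Local Notation "\sum_ ( m <= i < n ) F" :=
  (\big[Rplus/0%R]_(m <= i < n) F%R) : R_scope.
Local Notation "\prod_ ( m <= i < n | P ) F" :=
  (\big[Rmult/1%R]_(m <= i < n | P%B) F%R) : R_scope.
Local Notation "\prod_ ( m <= i < n ) F" :=
  (\big[Rmult/1%R]_(m <= i < n) F%R) : R_scope.
Local Notation "\csum_ ( m <= i < n | P ) F" :=
  (\big[Cplus/RtoC 0]_(m <= i < n | P%B) F%C)
  (at level 41, F at level 41, i, m, n at level 50).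
Local Notation "\csum_ ( m <= i < n ) F" :=
  (\big[Cplus/RtoC 0]_(m <= i < n) F%C)
  (at level 41, F at level 41, i, m, n at level 50).

Lemma le_sum m n (P : pred nat) (F G : nat -> R) :
  (forall i, (m <= i < n)%N -> P i -> F i <= G i) ->
  \sum_(m <= i < n | P i) F i <= \sum_(m <= i < n | P i) G i.
Proof.
move=> H; rewrite big_nat_cond [X in _ <= X]big_nat_cond.
apply: (big_ind2 (fun x y => x <= y)).
- exact: Rle_refl.
- by move=> *; apply: Rplus_le_compat.
- by move=> i /andP[/H].
Qed.

Lemma sum_ge0 m n (P : pred nat) (F : nat -> R) :
  (forall i, (m <= i < n)%N -> P i -> 0 <= F i) ->
  0 <= \sum_(m <= i < n | P i) F i.
Proof.
move=> H; rewrite big_nat_cond.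
apply: (big_ind (fun x => 0 <= x)).
- exact: Rle_refl.
- by move=> *; lra.
- by move=> i /andP[/H].
Qed.

Lemma le_sum_subpred m n (P Q : pred nat) (F : nat -> R) :
  (forall i, (m <= i < n)%N -> P i -> Q i) ->
  (forall i, (m <= i < n)%N -> Q i -> 0 <= F i) ->
  \sum_(m <= i < n | P i) F i <= \sum_(m <= i < n | Q i) F i.
Proof.
move=> PQ F0; rewrite [X in _ <= X](bigID P) /=.
rewrite [X in _ <= X + _](_ : _ = \sum_(m <= i < n | P i) F i); last first.
  rewrite big_nat_cond [RHS]big_nat_cond; apply: eq_bigl => i.
  case Hi: (m <= i < n)%N => //=.
  by case HP: (P i); rewrite ?andbF // (PQ _ Hi HP).
suff: 0 <= \sum_(m <= i < n | Q i && ~~ P i) F i by lra.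
by apply: sum_ge0 => i Hi /andP[/(F0 _ Hi)].
Qed.

Lemma le_sum_range a b c d (P : pred nat) (F : nat -> R) : (c <= a)%N -> (b <= d)%N ->
  (forall i, (c <= i < d)%N -> P i -> 0 <= F i) ->
  \sum_(a <= i < b | P i) F i <= \sum_(c <= i < d | P i) F i.
Proof.
move=> ca bd F0; case: (ltnP a b) => [ab|ba]; last first.
  by rewrite big_geq //; apply: sum_ge0.
rewrite [X in _ <= X](@big_cat_nat _ _ _ a) //=; last by lia.
rewrite [X in _ <= _ + X](@big_cat_nat _ _ _ b) //=; last by lia.
have h1 : 0 <= \sum_(c <= i < a | P i) F i by apply: sum_ge0 => i ?; apply: F0; lia.
have h2 : 0 <= \sum_(b <= i < d | P i) F i by apply: sum_ge0 => i ?; apply: F0; lia.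
by lra.
Qed.

Lemma sum_const m n (P : pred nat) c :
  \sum_(m <= i < n | P i) c = INR (count P (index_iota m n)) * c.
Proof.
rewrite -big_filter -size_filter.
elim: [seq i <- _ | _] => [|x s IH]; first by rewrite big_nil /= Rmult_0_l.
by rewrite big_cons IH -[size (x :: s)]/(size s).+1 S_INR /=; ring.
Qed.

Lemma Cmod_csum_le m n (P : pred nat) (F : nat -> C) (G : nat -> R) :
  (forall i, (m <= i < n)%N -> P i -> Cmod (F i) <= G i) ->
  Cmod (\csum_(m <= i < n | P i) F i) <= \sum_(m <= i < n | P i) G i.
Proof.
move=> H; rewrite big_nat_cond [X in _ <= X]big_nat_cond.
apply: (big_ind2 (fun x y => Cmod x <= y)).
- by rewrite Cmod_0; apply: Rle_refl.
- move=> x y z t Hx Hz; apply: Rle_trans (Cmod_triangle _ _) _; lra.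
- by move=> i /andP[/H].
Qed.

(** * Sieving a sum by the power of a prime dividing the index *)

Definition cop (D : seq nat) (n : nat) : bool := all (fun p => ~~ (p %| n)%N) D.

Section Sieve.

Context {V : Type} {idx : V} {op : Monoid.com_law idx}.
Implicit Types (F : nat -> V) (P : pred nat) (D : seq nat).

(** Induction on [N]: the quotient [N %/ p] increases exactly when [N.+1] is a multiple of [p]. The
    section is stated for any commutative monoid because it serves both real and complex sums. *)
Lemma big_multiples p N F P : (0 < p)%N ->
  \big[op/idx]_(1 <= n < N.+1 | (p %| n) && P n) F n =
  \big[op/idx]_(1 <= m < (N %/ p).+1 | P (p * m)%N) F (p * m)%N.
Proof.
move=> p0; elim: N => [|N IH]; first by rewrite div0n !big_geq.
rewrite big_mkcond big_nat_recr //= -big_mkcond IH divnS //.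
case: (boolP (p %| N.+1)%N) => [pN|_]; last by rewrite add0n Monoid.mulm1.
rewrite add1n [RHS]big_mkcond [RHS]big_nat_recr //= -big_mkcond; congr (op _ _).
suff -> : (p * (N %/ p).+1)%N = N.+1 by [].
by rewrite -[in RHS](divnK pN) divnS // pN add1n mulnC.
Qed.

Lemma cop_mul p D m : prime p -> all prime D -> p \notin D ->
  cop D (p * m)%N = cop D m.
Proof.
move=> pp; elim: D => //= q D IH /andP[qp Dp]; rewrite inE negb_or => /andP[pq pD].
by rewrite IH // Euclid_dvdM // dvdn_prime2 // eq_sym (negbTE pq).
Qed.

Lemma big_sieve1 p D N F : prime p -> all prime D -> p \notin D ->
  \big[op/idx]_(1 <= n < N.+1 | cop D n) F n =
  op (\big[op/idx]_(1 <= n < N.+1 | cop (p :: D) n) F n)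
     (\big[op/idx]_(1 <= m < (N %/ p).+1 | cop D m) F (p * m)%N).
Proof.
move=> pp Dp pD; rewrite (bigID (fun n => p %| n)%N) /= Monoid.mulmC.
congr (op _ _); first by apply: eq_bigl => n; rewrite andbC.
under eq_bigl => n do rewrite andbC.
rewrite big_multiples ?prime_gt0 //.
by apply: eq_bigl => m; rewrite cop_mul.
Qed.

Lemma big_sieve_upto p D N F K : prime p -> all prime D -> p \notin D ->
  \big[op/idx]_(1 <= n < N.+1 | cop D n) F n =
  op (\big[op/idx]_(0 <= v < K)
       \big[op/idx]_(1 <= m < (N %/ p ^ v).+1 | cop (p :: D) m) F (p ^ v * m)%N)
     (\big[op/idx]_(1 <= m < (N %/ p ^ K).+1 | cop D m) F (p ^ K * m)%N).
Proof.
move=> pp Dp pD; elim: K => [|K ->].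
  rewrite [X in op X _]big_geq // Monoid.mul1m expn0 divn1.
  by apply: eq_bigr => m _; rewrite mul1n.
rewrite big_nat_recr //= -Monoid.mulmA; congr (op _ _).
rewrite (@big_sieve1 p) // -divnMA -expnSr; congr (op _ _).
by apply: eq_bigr => m _; rewrite mulnA -expnSr.
Qed.

Lemma big_sieve p D N F : prime p -> all prime D -> p \notin D ->
  \big[op/idx]_(1 <= n < N.+1 | cop D n) F n =
  \big[op/idx]_(0 <= v < N.+1)
    \big[op/idx]_(1 <= m < (N %/ p ^ v).+1 | cop (p :: D) m) F (p ^ v * m)%N.
Proof.
move=> pp Dp pD; rewrite (@big_sieve_upto p _ _ _ N.+1) //.
(* Since [p ^ N.+1 > N], the remainder sum is empty. *)
rewrite [X in op _ X]big_geq ?Monoid.mulm1 // divn_small //.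
by apply: ltn_trans (ltn_expl _ (prime_gt1 pp)).
Qed.

End Sieve.

(** * Estimates for real functions *)

(** The summand 1 keeps this logarithm at least 1, so its powers of either sign make sense from
    [n = 1] on and the induction can start there. *)
Definition ell (n : nat) : R := 1 + ln (INR n).

Lemma INR_gt0 n : (0 < n)%N -> 0 < INR n.
Proof. by move=> n0; apply: lt_0_INR; apply/ltP. Qed.

Lemma INR_le m n : (m <= n)%N -> INR m <= INR n.
Proof. by move=> h; apply: le_INR; apply/leP. Qed.

Lemma INR_ge1 n : (0 < n)%N -> 1 <= INR n.
Proof. exact: (@INR_le 1). Qed.

Lemma INR_mul m n : INR (m * n)%N = INR m * INR n.
Proof. exact: mult_INR. Qed.

Lemma INR_exp m n : INR (m ^ n)%N = INR m ^ n.
Proof. by elim: n => //= n <-; rewrite expnS INR_mul. Qed.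

Lemma le_ln x y : 0 < x -> x <= y -> ln x <= ln y.
Proof. by move=> x0 [/(ln_increasing _ _ x0)|->]; lra. Qed.

Lemma ln_ge0 x : 1 <= x -> 0 <= ln x.
Proof. by move=> x1; rewrite -ln_1; apply: le_ln; lra. Qed.

(* Includes [n = 0], where [ln 0 = 0]. *)
Lemma ln_INR_ge0 n : 0 <= ln (INR n).
Proof.
case: n => [|n]; last exact/ln_ge0/INR_ge1.
rewrite (_ : INR 0 = 0) // /ln.
by case: Rlt_dec => [/Rlt_irrefl|_] //; apply: Rle_refl.
Qed.

Lemma ell_ge1 n : 1 <= ell n.
Proof. by have := ln_INR_ge0 n; rewrite /ell; lra. Qed.

Lemma le_exp x y : x <= y -> exp x <= exp y.
Proof. by case=> [/exp_increasing|->]; lra. Qed.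

Lemma ln_le_sub1 x : 0 < x -> ln x <= x - 1.
Proof.
by move=> x0; have := exp_ineq1_le (ln x); rewrite exp_ln //; lra.
Qed.

Lemma Rpower_gt0 x y : 0 < Rpower x y.
Proof. exact: exp_pos. Qed.

Lemma Rpower_le_exp (a b : R) : 0 < a ->
  exists2 C, 0 < C & forall t, 1 <= t -> Rpower t b <= C * exp (a * t).
Proof.
move=> a0; case: (Rle_or_lt b 0) => [b0|b0].
  exists 1; first lra.
  move=> t t1; rewrite Rmult_1_l; apply: le_exp.
  by have := ln_ge0 t1; nra.
(* The constant is (b/a)^b: multiply log y <= y - 1 by b at y = at/b. *)
exists (exp (b * ln (b / a))); first exact: exp_pos.
move=> t t1; rewrite -exp_plus; apply: le_exp.
have ba : 0 < b / a by apply: Rdiv_lt_0_compat.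
have := ln_le_sub1 (x := t / (b / a)); rewrite ln_div //; last lra.
have e : b * (t / (b / a)) = a * t by field; lra.
move=> /(_ (Rdiv_lt_0_compat _ _ _ ba)) h.
have {}h : ln t - ln (b / a) <= t / (b / a) - 1 by apply: h; lra.
by have := Rmult_le_compat_l b _ _ (Rlt_le _ _ b0) h; nra.
Qed.

(** Comparability in both directions is assumed so that the exponent may have either sign, as k - 1
    - A does. *)
Lemma Rpower_compare (b c x y : R) : 0 < x -> 0 < y -> 1 <= c ->
  x <= c * y -> y <= c * x -> Rpower x b <= Rpower c (Rabs b) * Rpower y b.
Proof.
move=> x0 y0 c1 xy yx; rewrite /Rpower -exp_plus; apply: le_exp.
have h1 := le_ln x0 xy; have h2 := le_ln y0 yx.
rewrite ln_mult in h1; try lra.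
rewrite ln_mult in h2; try lra.
have c0 := ln_ge0 c1.
by rewrite /Rabs; case: Rcase_abs => hb; nra.
Qed.

Lemma ell_div q N : (0 < q)%N -> (0 < N)%N ->
  ell N = ell q + ln (INR N / INR q).
Proof.
by move=> q0 N0; rewrite /ell ln_div; try apply: INR_gt0 => //; lra.
Qed.

Lemma Rdiv_ge1 x y : 0 < y -> y <= x -> 1 <= x / y.
Proof.
move=> y0 yx; rewrite -(Rinv_r y); last lra.
by apply: Rmult_le_compat_r => //; left; apply: Rinv_0_lt_compat.
Qed.

(** The ratio of [ell N] to [ell q] is at most 1 + log(N/q), and any power of that is
    O((N/q)^(1/4)). The exponent 1/4 is small enough that the sum of (N/n)^(1/4) over n <= N is
    O(N), and that p^(-3v/4) is summable over primes p and v >= 2. *)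
Lemma ell_slowly_varying (b : R) : exists2 C, 0 < C &
  forall q N, (0 < q <= N)%N ->
  Rpower (ell q) b <= C * Rpower (INR N / INR q) (1 / 4) * Rpower (ell N) b.
Proof.
have [C C0 H] := @Rpower_le_exp (1 / 4) (Rabs b) ltac:(lra).
exists (C * exp (1 / 4)); first by apply: Rmult_lt_0_compat => //; apply: exp_pos.
move=> q N /andP[q0 qN].
have N0 := leq_trans q0 qN.
have r1 := Rdiv_ge1 (INR_gt0 q0) (INR_le qN).
have l0 := ln_ge0 r1.
have q1 := ell_ge1 q; have e := ell_div q0 N0.
apply: Rle_trans (@Rpower_compare b (1 + ln (INR N / INR q)) _ (ell N) _ _ _ _ _) _;
  try nra.
apply: Rmult_le_compat_r; first exact/Rlt_le/Rpower_gt0.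
apply: Rle_trans (H _ _) _; first lra.
by rewrite /Rpower Rmult_assoc -exp_plus; right; congr (_ * exp _); ring.
Qed.

Lemma sum_inv_sqrt N : \sum_(1 <= n < N.+1) (/ sqrt (INR n)) <= 2 * sqrt (INR N).
Proof.
elim: N => [|N IH]; first by rewrite big_geq // (_ : INR 0 = 0) // sqrt_0; lra.
rewrite big_nat_recr //=.
set s := sqrt (INR N) in IH *.
have t0 : 0 < sqrt (INR N.+1) by apply/sqrt_lt_R0/INR_gt0.
set t := sqrt (INR N.+1) in t0 *.
have s0 : 0 <= s by apply: sqrt_pos.
have h : t * t = s * s + 1.
  by rewrite /t /s !sqrt_sqrt ?S_INR //; have := pos_INR N; lra.
(* The right side telescopes. Multiplied by [t], the inequality becomes (t - s)^2 >= 0, because t^2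
   = s^2 + 1. *)
suff : / t <= 2 * t - 2 * s by lra.
apply: (Rmult_le_reg_r t) => //; rewrite Rinv_l; last lra.
have : 0 <= (t - s) * (t - s) by exact: Rle_0_sqr.
nra.
Qed.

(** Each ratio is at least 1, so its fourth root is at most its square root. *)
Lemma sum_Rpower_ratio N :
  \sum_(1 <= n < N.+1) Rpower (INR N / INR n) (1 / 4) <= 2 * INR N.
Proof.
have -> : 2 * INR N = sqrt (INR N) * (2 * sqrt (INR N)).
  by rewrite -{1}(sqrt_sqrt (INR N) (pos_INR N)); ring.
apply: Rle_trans (Rmult_le_compat_l _ _ _ (sqrt_pos _) (sum_inv_sqrt N)).
rewrite big_distrr /=; apply: le_sum => n /andP[n1 nN] _.
have n0 := INR_gt0 n1.
have r1 : 1 <= INR N / INR n by apply: Rdiv_ge1 => //; apply: INR_le.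
rewrite -[_ * / _]/(sqrt (INR N) / sqrt (INR n)) -sqrt_div_alt //.
rewrite -Rpower_sqrt; last lra.
by apply: Rle_Rpower; lra.
Qed.

(** Comparison with the integral of x^(-1-u), in telescoping form: for N >= 1 the sum is at most 1 +
    1/u - N^(-u)/u. The inductive step reduces to 1 + u/(n+1) <= (n/(n+1))^(-u). *)
Lemma zeta_partial_le (u : R) N : 0 < u ->
  \sum_(1 <= n < N.+1) Rpower (INR n) (- (1 + u)) <= 1 + / u.
Proof.
move=> u0; have iu := Rinv_0_lt_compat _ u0.
case: N => [|N]; first by rewrite big_geq //; lra.
suff : \sum_(1 <= n < N.+2) Rpower (INR n) (- (1 + u)) <=
       1 + / u - / u * Rpower (INR N.+1) (- u).
  by have := Rpower_gt0 (INR N.+1) (- u); nra.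
elim: N => [|N IH].
  by rewrite big_nat1 (_ : INR 1 = 1) // /Rpower ln_1 !Rmult_0_r exp_0; lra.
rewrite big_nat_recr //=.
set n := N.+1 in IH *; have n0 : 0 < INR n by apply: INR_gt0.
have m0 : 0 < INR n.+1 by apply: INR_gt0.
suff : Rpower (INR n.+1) (- (1 + u)) <=
   / u * Rpower (INR n) (- u) - / u * Rpower (INR n.+1) (- u) by lra.
have -> : Rpower (INR n.+1) (- (1 + u)) = / INR n.+1 * Rpower (INR n.+1) (- u).
  by rewrite -[in / _](Rpower_1 _ m0) -Rpower_Ropp -Rpower_plus; f_equal; ring.
have -> : Rpower (INR n) (- u) =
    Rpower (INR n.+1) (- u) * Rpower (INR n / INR n.+1) (- u).
  by rewrite /Rpower -exp_plus ln_div //; f_equal; ring.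
have h : 1 + u * / INR n.+1 <= Rpower (INR n / INR n.+1) (- u).
  apply: Rle_trans (exp_ineq1_le _) (le_exp _).
  have := ln_le_sub1 (Rdiv_lt_0_compat _ _ n0 m0).
  have -> : INR n / INR n.+1 - 1 = - / INR n.+1.
    by rewrite S_INR; field; rewrite -S_INR; lra.
  by nra.
have P0 := Rpower_gt0 (INR n.+1) (- u).
have := Rmult_le_compat_l (/ u * Rpower (INR n.+1) (- u)) _ _ _ h.
rewrite Rmult_plus_distr_l Rmult_1_r.
have -> : / u * Rpower (INR n.+1) (- u) * (u * / INR n.+1) =
  / INR n.+1 * Rpower (INR n.+1) (- u) by field; lra.
by move=> hh; have {}hh := hh ltac:(nra); lra.
Qed.

(** * List folds as big operators, and the binomial series *)

Lemma fold_right_map_big {V : Type} (op : V -> V -> V) (idx : V) (F : nat -> V)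
    (s : seq nat) :
  List.fold_right op idx (List.map F s) = \big[op/idx]_(i <- s) F i.
Proof. by elim: s => [|x s IH]; rewrite ?big_nil ?big_cons //= IH. Qed.

Lemma List_seq_iota m n : ListDef.seq m n = seq.iota m n.
Proof. by elim: n m => //= n IH m; rewrite IH. Qed.

(* Coefficients of the binomial series [(1 - z)^(-k)]. *)
Definition gb (k : R) (v : nat) : R := gbinom (k + INR v - 1) v.

Lemma gbE k v : gb k v = \prod_(0 <= j < v) ((k + INR j) / (INR j + 1)).
Proof.
rewrite /gb /gbinom fold_right_map_big List_seq_iota.
have -> : seq.iota 0 v = index_iota 0 v by rewrite /index_iota subn0.
rewrite big_split [RHS]big_split /=; congr (_ * _).
(* Only the numerators are reversed: the factors k + v - 1 - i become k + j. *)
rewrite big_nat_rev /=; apply: eq_big_nat => j /andP[_ jv].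
rewrite add0n; have -> : INR (v - j.+1)%N = INR v - INR j.+1.
  by rewrite minus_INR //; apply/leP.
by rewrite S_INR; ring.
Qed.

Lemma gb0 k : gb k 0 = 1.
Proof. by rewrite gbE big_geq. Qed.

Lemma gb1 k : gb k 1 = k.
Proof. by rewrite gbE big_nat1 (_ : INR 0 = 0) //; field. Qed.

Lemma gbS k v : gb k v.+1 * INR v.+1 = gb k v * (k + INR v).
Proof.
rewrite !gbE big_nat_recr //= S_INR; field.
by have := pos_INR v; lra.
Qed.

Lemma gb_ge0 k v : 0 < k -> 0 <= gb k v.
Proof.
move=> k0; rewrite gbE; apply: (big_ind (fun x => 0 <= x)); first lra.
  by move=> *; apply: Rmult_le_pos.
move=> j _; have := pos_INR j => j0.
by left; apply: Rdiv_lt_0_compat; lra.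
Qed.

(** The truncated series P satisfies (1 - x) P' = k P, the differential equation of (1 - x)^(-k), up
    to a nonpositive error. This gives the upper bound without any convergence argument. *)
Lemma gb_series_le k z V : 0 < k -> 0 <= z < 1 ->
  \sum_(0 <= v < V) (gb k v * z ^ v) <= Rpower (1 - z) (- k).
Proof.
move=> k0 [z0 z1].
pose P x := \sum_(0 <= v < V) (gb k v * x ^ v).
pose D x := \sum_(0 <= v < V) (gb k v * (INR v * x ^ v.-1)).
have dP x : is_derive P x (D x).
  rewrite /P /D; elim: V {P D} => [|V IH].
    rewrite big_geq //; apply: (is_derive_ext (fun=> 0)) (is_derive_const _ _).
    by move=> t; rewrite big_geq.
  rewrite big_nat_recr //=.
  apply: (is_derive_ext
    (fun x => plus (\sum_(0 <= v < V) (gb k v * x ^ v)) (gb k V * x ^ V))).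
    by move=> t; rewrite big_nat_recr.
  apply: is_derive_plus => //.
  by auto_derive => //; ring.
have eqD x : (1 - x) * D x - k * P x = - (gb k V * INR V * x ^ V.-1).
  rewrite /P /D; elim: V {P D dP} => [|V IH].
    by rewrite !big_geq // (_ : INR 0 = 0) //; ring.
  rewrite !big_nat_recr //= gbS.
  case: V IH => [|V] /=; first by rewrite !big_geq // (_ : INR 0 = 0) // => _; ring.
  by move=> e; lra.
(* [phi x = (1 - x)^k * P x] is nonincreasing, by [eqD]. *)
pose phi x := P x * exp (k * ln (1 - x)).
pose dphi x := - (gb k V * INR V * x ^ V.-1) * (/ (1 - x) * exp (k * ln (1 - x))).
have dphiP x : 0 <= x <= z -> is_derive phi x (dphi x).
  move=> [x0 xz].
  have -> : dphi x = plus (mult (D x) (exp (k * ln (1 - x))))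
     (mult (P x) (k * (- / (1 - x)) * exp (k * ln (1 - x)))).
    by rewrite /dphi -eqD; rewrite /plus /mult /=; field; lra.
  apply: (is_derive_mult P); [exact: dP | | by move=> *; apply: Rmult_comm].
  auto_derive; first lra.
  by rewrite /Rminus; field; lra.
have [||c [[c0 cz] e]] := MVT_gen phi 0 z dphi.
- by move=> x; rewrite Rmin_left // Rmax_right // => ?; apply: dphiP; lra.
- move=> x; rewrite Rmin_left // Rmax_right // => xz.
  apply/continuity_pt_filterlim/(@ex_derive_continuous _ R_NormedModule).
  by exists (dphi x); apply: dphiP.
rewrite Rmin_left // in c0; rewrite Rmax_right // in cz.
have P0 : P 0 <= 1.
  rewrite /P; case: (V) => [|n]; first by rewrite big_geq //; lra.
  rewrite big_nat_recl // gb0 /=.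
  suff -> : \sum_(0 <= i < n) (gb k i.+1 * (0 * 0 ^ i)) = 0 by lra.
  by apply: big1 => i _; ring.
have phi1 : phi z <= 1.
  suff : phi z - phi 0 <= 0.
    by rewrite {2}/phi Rminus_0_r ln_1 Rmult_0_r exp_0; lra.
  rewrite e Rminus_0_r; suff : dphi c <= 0 by nra.
  rewrite /dphi -Ropp_mult_distr_l; apply/Rge_le/Ropp_0_le_ge_contravar.
  apply: Rmult_le_pos.
    apply: Rmult_le_pos; last by apply: pow_le.
    by apply: Rmult_le_pos; [apply: gb_ge0 | apply: pos_INR].
  apply: Rmult_le_pos; last exact/Rlt_le/exp_pos.
  by left; apply: Rinv_0_lt_compat; lra.
rewrite Rpower_Ropp; apply: (Rmult_le_reg_r (Rpower (1 - z) k)).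
  exact: Rpower_gt0.
by rewrite Rinv_l //; apply/Rgt_not_eq/Rpower_gt0.
Qed.

(** * Valuations and the divisor function *)

Lemma dvdn_divide a b : reflect (Nat.divide a b) (a %| b)%N.
Proof. exact: dvdnP. Qed.

Lemma is_primebE p : is_primeb p = prime p.
Proof.
rewrite /is_primeb; case: Znumtheory.prime_dec => [pp|pp]; symmetry.
  apply/primeP; move/Znumtheory.prime_alt: pp => [p1 H]; split; first lia.
  move=> d dp; apply/orP.
  have p0 : (0 < p)%N by lia.
  have dlep := dvdn_leq p0 dp; have d0 := dvdn_gt0 p0 dp.
  case: (eqVneq d 1%N) => [|d1]; first by left.
  case: (eqVneq d p) => [|dnp]; first by right.
  exfalso; apply: (H (Z.of_nat d)); first by lia.
  by case/dvdnP: dp => e ->; exists (Z.of_nat e); lia.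
apply/negbTE/negP => /primeP[p1 H]; apply: pp; apply/Znumtheory.prime_alt.
split; first lia.
move=> n n1 [e pe].
have /H : (Z.to_nat n %| p)%N by apply/dvdnP; exists (Z.to_nat e); nia.
by move=> /orP[] /eqP; lia.
Qed.

Lemma Nat_modE n p : (n mod p =? 0)%coq_nat = (p %| n)%N.
Proof.
apply/idP/idP => [/PeanoNat.Nat.eqb_eq h|/dvdn_divide h].
  by apply/dvdn_divide/PeanoNat.Nat.Lcm0.mod_divide.
by apply/PeanoNat.Nat.eqb_eq/PeanoNat.Nat.Lcm0.mod_divide.
Qed.

Lemma pvalE p n : prime p -> (0 < n)%N -> pval p n = logn p n.
Proof.
move=> pp n0; rewrite /pval.
suff H fuel : (n <= fuel)%N -> val_aux fuel p n = logn p n by exact: H.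
elim: fuel n n0 => [|fuel IH] n n0 nf; first by lia.
rewrite /= Nat_modE.
have -> : (1 <? p)%coq_nat = true.
  by apply/PeanoNat.Nat.ltb_lt; have := prime_gt1 pp; lia.
have -> : (0 <? n)%coq_nat = true by apply/PeanoNat.Nat.ltb_lt; lia.
case: (boolP (p %| n)%N) => [|pn] /=; last by rewrite lognE pp n0 (negbTE pn).
case/dvdnP => e ne; rewrite ne PeanoNat.Nat.div_mul; last by have := prime_gt0 pp; lia.
have p1 := prime_gt1 pp; have e0 : (0 < e)%N by nia.
have p0 := prime_gt0 pp.
by rewrite lognM // (logn_prime p pp) eqxx addn1 IH //; nia.
Qed.

(** Primes above [n] contribute [gb k 0 = 1], so any [M >= n] may be the range; this lets two values
    of [tau] be compared over the same primes. *)
Lemma tauE k n M : (0 < n <= M)%N ->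
  tau k n = \prod_(1 <= p < M.+1 | prime p) gb k (logn p n).
Proof.
move=> /andP[n0 nM]; rewrite /tau fold_right_map_big List_seq_iota.
have -> : seq.iota 1 n = index_iota 1 n.+1 by rewrite /index_iota subn1.
rewrite [RHS](@big_cat_nat _ _ _ n.+1) //= [X in _ = _ * X]big1_seq ?Rmult_1_r.
  rewrite [RHS]big_mkcond; apply: eq_bigr => p _; rewrite is_primebE.
  by case: (boolP (prime p)) => // pp; rewrite pvalE.
move=> p /andP[pp]; rewrite mem_index_iota => /andP[np _].
by rewrite lognE pp n0 gtnNdvd // gb0.
Qed.

Lemma tau_ge0 k n : 0 < k -> (0 < n)%N -> 0 <= tau k n.
Proof.
move=> k0 n0; rewrite (@tauE _ _ n) ?n0 ?leqnn //.
apply: (big_ind (fun x => 0 <= x)); first lra.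
  by move=> *; apply: Rmult_le_pos.
by move=> p _; apply: gb_ge0.
Qed.

Lemma tau_pfactorM k p v m : prime p -> (0 < m)%N -> ~~ (p %| m)%N ->
  tau k (p ^ v * m)%N = gb k v * tau k m.
Proof.
move=> pp m0 pm; have p0 := prime_gt0 pp.
have pv0 : (0 < p ^ v)%N by rewrite expn_gt0 p0.
(* A common range containing [p], [m] and [p ^ v * m]. *)
set M := (p * (p ^ v * m))%N.
have pvm0 : (0 < p ^ v * m)%N by rewrite muln_gt0 pv0.
have mM : (m <= M)%N by rewrite /M mulnA leq_pmull // muln_gt0 p0.
rewrite (@tauE _ _ M) ?(@tauE _ m M) ?m0 ?pvm0 //=; last by rewrite leq_pmull.
have -> : gb k v = \prod_(1 <= q < M.+1 | prime q) (if q == p then gb k v else 1).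
  by rewrite -big_mkcondr big_nat1_cond_eq p0 ltnS leq_pmulr ?pp.
rewrite -big_split; apply: eq_bigr => q qp /=.
rewrite lognM // lognX logn_prime //; case: eqP => [->|_]; last first.
  by rewrite muln0 Rmult_1_l.
by rewrite muln1 (lognE p m) (negbTE pm) !andbF gb0 addn0 Rmult_1_r.
Qed.

Lemma tau_pfactor k p v : prime p -> tau k (p ^ v)%N = gb k v.
Proof.
move=> pp; have := @tau_pfactorM k p v 1 pp isT.
rewrite muln1 dvdn1 => ->; last by have := prime_gt1 pp; lia.
rewrite (@tauE _ 1 1) // big1 ?Rmult_1_r // => q _.
by rewrite logn1 gb0.
Qed.

Lemma Nat_gcd_coprime m n : coprime m n -> Nat.gcd m n = 1%N.
Proof.
move=> /eqP h; have : (Nat.gcd m n %| gcdn m n)%N.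
  rewrite dvdn_gcd; apply/andP; split; apply/dvdn_divide.
    exact: PeanoNat.Nat.gcd_divide_l.
  exact: PeanoNat.Nat.gcd_divide_r.
by rewrite h dvdn1 => /eqP.
Qed.

Lemma multiplicative_pfactorM f p v m :
  multiplicative f -> prime p -> (0 < m)%N -> ~~ (p %| m)%N ->
  f (p ^ v * m)%N = Cmult (f (p ^ v)%N) (f m).
Proof.
move=> [_ H] pp m0 pm; apply: H.
- by apply/ltP; rewrite expn_gt0 prime_gt0.
- exact/ltP.
- by apply: Nat_gcd_coprime; rewrite coprimeXl // prime_coprime.
Qed.

(** * Euler products *)

Section EulerProduct.

Variable g : nat -> R.
Hypothesis g_ge0 : forall n, (0 < n)%N -> 0 <= g n.
Hypothesis gM : forall p v m, prime p -> (0 < m)%N -> ~~ (p %| m)%N ->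
  g (p ^ v * m)%N = g (p ^ v)%N * g m.

(** Sort the indices by their power of [p], then lengthen each inner range from [N %/ p ^ v] to [N],
    which nonnegativity allows. *)
Lemma euler_step_le p D N : prime p -> all prime D -> p \notin D ->
  \sum_(1 <= n < N.+1 | cop D n) g n <=
  (\sum_(0 <= v < N.+1) g (p ^ v)%N) * \sum_(1 <= n < N.+1 | cop (p :: D) n) g n.
Proof.
move=> pp Dp pD; rewrite (@big_sieve _ _ _ p) // big_distrl /=.
apply: le_sum => v _ _.
have pv0 : (0 < p ^ v)%N by rewrite expn_gt0 prime_gt0.
apply: (Rle_trans _ (g (p ^ v)%N *
    \sum_(1 <= m < (N %/ p ^ v).+1 | cop (p :: D) m) g m)).
  rewrite big_distrr /=; apply: le_sum => m /andP[m0 _] /andP[pm _].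
  by rewrite gM //; apply: Rle_refl.
apply: Rmult_le_compat_l; first exact: g_ge0.
by apply: le_sum_range; rewrite ?ltnS ?leq_div // => m /andP[m0 _] _; apply: g_ge0.
Qed.

(** The sum over indices free of [E] is kept as a factor so that the primes can be removed one at a
    time; when [E] lists the primes up to [N], only the index 1 is left in it. *)
Lemma euler_prod_le (G : nat -> R) E N : all prime E -> uniq E ->
  (forall p, prime p -> \sum_(0 <= v < N.+1) g (p ^ v)%N <= G p) ->
  \sum_(1 <= n < N.+1) g n <=
  (\big[Rmult/1]_(p <- E) G p) * \sum_(1 <= n < N.+1 | cop E n) g n.
Proof.
move=> Ep uE HG.
suff [] : 0 <= \big[Rmult/1]_(p <- E) G p /\ \sum_(1 <= n < N.+1) g n <=
  (\big[Rmult/1]_(p <- E) G p) * \sum_(1 <= n < N.+1 | cop E n) g n by [].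
elim: E Ep uE => [|p E IH] /=; first by rewrite !big_nil; split; lra.
move=> /andP[pp Ep] /andP[pE uE]; have [P0 IHE] := IH Ep uE.
have Gp : 0 <= G p.
  apply: Rle_trans (HG p pp); apply: sum_ge0 => v _ _; apply: g_ge0.
  by rewrite expn_gt0 prime_gt0.
rewrite big_cons /=; split; first exact: Rmult_le_pos.
apply: Rle_trans IHE _; rewrite (Rmult_comm (G p)) Rmult_assoc.
apply: Rmult_le_compat_l => //; apply: Rle_trans (euler_step_le _ pp Ep pE) _.
apply: Rmult_le_compat_r; last exact: HG.
by apply: sum_ge0 => n /andP[n0 _] _; apply: g_ge0.
Qed.

End EulerProduct.

Definition primes_upto N := [seq p <- index_iota 1 N.+1 | prime p].

Lemma primes_upto_prime N : all prime (primes_upto N).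
Proof. exact: filter_all. Qed.

Lemma primes_upto_uniq N : uniq (primes_upto N).
Proof. by rewrite filter_uniq // iota_uniq. Qed.

Lemma cop_primes_upto N n : (0 < n <= N)%N -> cop (primes_upto N) n -> n = 1%N.
Proof.
move=> /andP[n0 nN] /allP H; case: (ltnP 1 n) => [n1|]; last by lia.
have := H (pdiv n); rewrite pdiv_dvd mem_filter pdiv_prime // mem_index_iota.
by rewrite pdiv_gt0 ltnS (leq_trans (pdiv_leq n0) nN) => /(_ isT).
Qed.

Section ZetaProduct.

Variables (h : nat -> R) (B : R).
Hypothesis h_ge0 : forall n, 0 <= h n.
Hypothesis h1 : h 1%N = 1.
Hypothesis hM : forall m n, (0 < m)%N -> (0 < n)%N -> h (m * n)%N = h m * h n.
Hypothesis h_lt1 : forall p, prime p -> h p < 1.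
Hypothesis hB : forall N, \sum_(1 <= n < N.+1) h n <= B.

Lemma mult_exp p v : (0 < p)%N -> h (p ^ v)%N = h p ^ v.
Proof.
by move=> p0; elim: v => [|v IH] //=; rewrite expnS hM ?expn_gt0 ?p0 // IH.
Qed.

(** Removing one prime multiplies a bound valid for all partial sums by 1 - h(p). The argument stays
    with finite sums: truncate the geometric series in h(p) at [K], then let [K] grow. *)
Lemma zeta_step p D : prime p -> all prime D -> p \notin D ->
  forall B, (forall M, \sum_(1 <= n < M.+1 | cop D n) h n <= B) ->
  forall M, \sum_(1 <= n < M.+1 | cop (p :: D) n) h n <= B * (1 - h p).
Proof.
move=> pp Dp pD B' HB M; have p0 := prime_gt0 pp.
set Z := \sum_(_ <= n < _ | _) _.
have hp0 := h_ge0 p; have hp1 := h_lt1 pp.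
have Z0 : 0 <= Z by apply: sum_ge0.
have key K : Z * (1 - h p ^ K) <= B' * (1 - h p).
  have geo : 1 - h p ^ K = (\sum_(0 <= v < K) h p ^ v) * (1 - h p).
    elim: K => [|K IH]; first by rewrite big_geq //=; ring.
    by rewrite big_nat_recr //= Rmult_plus_distr_r -IH; ring.
  rewrite geo -Rmult_assoc; apply: Rmult_le_compat_r; first lra.
  (* At this length, every block with v < K still contains all m <= M. *)
  apply: Rle_trans (HB (p ^ K * M)%N).
  rewrite (@big_sieve_upto _ _ _ p _ _ _ K) //= big_distrr /=.
  suff H : \sum_(0 <= v < K) (Z * h p ^ v) <= \sum_(0 <= v < K)
     \sum_(1 <= m < ((p ^ K * M) %/ p ^ v).+1 | cop (p :: D) m) h (p ^ v * m)%N.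
    apply: Rle_trans H _; rewrite -[X in X <= _]Rplus_0_r.
    by apply: Rplus_le_compat_l; apply: sum_ge0.
  apply: le_sum => v /andP[_ vK] _.
  have pv0 : (0 < p ^ v)%N by rewrite expn_gt0 p0.
  have Mle : (M <= (p ^ K * M) %/ p ^ v)%N.
    by rewrite leq_divRL // mulnC leq_mul2r leq_exp2l ?prime_gt1 // (ltnW vK) orbT.
  rewrite (@big_cat_nat _ _ _ M.+1) //= -[X in X <= _]Rplus_0_r.
  apply: Rplus_le_compat; last by apply: sum_ge0.
  rewrite /Z Rmult_comm big_distrr /=; apply: le_sum => m /andP[m0 _] _.
  by rewrite hM // mult_exp //; apply: Rle_refl.
(* Otherwise a [K] with [Z * h p ^ K] below the gap [Z - B' * (1 - h p)] contradicts [key]. *)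
apply: Rnot_lt_le => lt.
have B0 : 0 <= B' by have := HB 0%N; rewrite big_geq.
have Zp : 0 < Z by nra.
have hp : Rabs (h p) < 1 by rewrite Rabs_pos_eq; lra.
have eps0 : 0 < (Z - B' * (1 - h p)) / Z by apply: Rdiv_lt_0_compat; lra.
have [K HK] := pow_lt_1_zero _ hp _ eps0.
have := HK K (le_n _); rewrite Rabs_pos_eq; last exact: pow_le.
move=> /(Rmult_lt_compat_l _ _ _ Zp).
have -> : Z * ((Z - B' * (1 - h p)) / Z) = Z - B' * (1 - h p) by field; lra.
by have := key K; lra.
Qed.

(** In other words, the finite Euler product of 1/(1 - h(p)) over [E] is at most [B]; the index 1
    alone gives the lower bound 1. *)
Lemma zeta_prod E : all prime E -> uniq E ->
  1 <= B * \big[Rmult/1]_(p <- E) (1 - h p).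
Proof.
move=> Ep uE.
suff H M : \sum_(1 <= n < M.+1 | cop E n) h n <= B * \big[Rmult/1]_(p <- E) (1 - h p).
  apply: Rle_trans (H 1%N); rewrite big_mkcond big_nat1.
  suff -> : cop E 1 by rewrite h1; apply: Rle_refl.
  apply/allP => p /(allP Ep) pp; rewrite dvdn1.
  by have := prime_gt1 pp; case: p {pp} => [|[]].
elim: E Ep uE M => [|p E IH] /=; first by rewrite big_nil Rmult_1_r => _ _ M.
move=> /andP[pp Ep] /andP[pE uE] M.
rewrite big_cons /= (Rmult_comm (1 - h p)) -Rmult_assoc.
by apply: zeta_step => // {}M; apply: IH.
Qed.

End ZetaProduct.

Lemma Rpower_1_l s : Rpower 1 s = 1.
Proof. by rewrite /Rpower ln_1 Rmult_0_r exp_0. Qed.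

Lemma Rpower_prod (s : seq nat) (F : nat -> R) a : (forall p, p \in s -> 0 < F p) ->
  0 < \big[Rmult/1]_(p <- s) F p /\
  \big[Rmult/1]_(p <- s) Rpower (F p) a = Rpower (\big[Rmult/1]_(p <- s) F p) a.
Proof.
elim: s => [|p s IH] H; first by rewrite !big_nil Rpower_1_l; split; lra.
have [q qs|P0 IHs] := IH; first by apply: H; rewrite inE qs orbT.
have Fp : 0 < F p by apply: H; rewrite inE eqxx.
rewrite !big_cons IHs; split; first exact: Rmult_lt_0_compat.
by rewrite /= Rpower_mult_distr.
Qed.

Lemma Rpower_INR_mul m n s : (0 < m)%N -> (0 < n)%N ->
  Rpower (INR (m * n)%N) s = Rpower (INR m) s * Rpower (INR n) s.
Proof. by move=> m0 n0; rewrite INR_mul Rpower_mult_distr //; apply: INR_gt0. Qed.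

Lemma Rpower_INR_1 s : Rpower (INR 1) s = 1.
Proof. exact: Rpower_1_l. Qed.

(** The sum is at most the product of (1 - p^(-1-u))^(-k) over p <= N. By [zeta_prod] this is at
    most the k-th power of any bound for the partial sums of zeta(1+u), here 1 + 1/u. *)
Lemma tau_dirichlet_le k u N : 0 < k -> 0 < u ->
  \sum_(1 <= n < N.+1) (tau k n * Rpower (INR n) (- (1 + u))) <= Rpower (1 + / u) k.
Proof.
move=> k0 u0; set h := fun n => Rpower (INR n) (- (1 + u)).
have h0 n : 0 < h n by apply: Rpower_gt0.
have hM m n : (0 < m)%N -> (0 < n)%N -> h (m * n)%N = h m * h n.
  exact: Rpower_INR_mul.
have hX p v : (0 < p)%N -> h (p ^ v)%N = h p ^ v.
  by apply: mult_exp => //; apply: Rpower_1_l.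
have h_lt1 p : prime p -> h p < 1.
  move=> /prime_gt1 p1; rewrite -exp_0; apply: exp_increasing.
  have : 0 < ln (INR p).
    by rewrite -ln_1; apply: ln_increasing; [lra | apply: (@lt_INR 1); lia].
  by nra.
pose E := primes_upto N.
have Ep := primes_upto_prime N; have uE := primes_upto_uniq N.
have iu := Rinv_0_lt_compat _ u0.
have zp := @zeta_prod h (1 + / u) (fun n => Rlt_le _ _ (h0 n))
  (Rpower_INR_1 _) hM h_lt1 (fun M => zeta_partial_le M u0) E Ep uE.
have gM p v m : prime p -> (0 < m)%N -> ~~ (p %| m)%N ->
  tau k (p ^ v * m)%N * h (p ^ v * m)%N =
  tau k (p ^ v)%N * h (p ^ v)%N * (tau k m * h m).
  move=> pp m0 pm; rewrite tau_pfactorM // tau_pfactor // hM //; first by ring.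
  by rewrite expn_gt0 prime_gt0.
have g0 n : (0 < n)%N -> 0 <= tau k n * h n.
  by move=> n0; apply: Rmult_le_pos; [exact: tau_ge0 | exact: Rlt_le].
have [p /(allP Ep)/h_lt1|P0 PE] := @Rpower_prod E (fun p => 1 - h p) (- k).
  by rewrite /=; lra.
apply: Rle_trans (@euler_prod_le _ g0 gM (fun p => Rpower (1 - h p) (- k)) E N Ep uE _) _.
  move=> p pp; apply: Rle_trans (gb_series_le N.+1 k0 _).
    right; apply: eq_bigr => v _; rewrite tau_pfactor // hX //; exact: prime_gt0.
  by have := h_lt1 p pp; have := h0 p; lra.
rewrite PE.
apply: (Rle_trans _ (Rpower (\big[Rmult/1]_(p <- E) (1 - h p)) (- k) * 1)).
  apply: Rmult_le_compat_l; first exact/Rlt_le/Rpower_gt0.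
  (* Among n <= N, only n = 1 is free of all primes up to [N]. *)
  case: (posnP N) => [->|N0]; first by rewrite big_geq //; lra.
  rewrite big_mkcond big_ltn //= [X in _ + X]big1_seq /=; last first.
    move=> n; rewrite mem_index_iota => /andP[n1 nN].
    case: ifP => // En.
    by have := @cop_primes_upto N n ltac:(lia) En; lia.
  case: ifP => _; last lra.
  by rewrite /h Rpower_INR_1 (@tau_pfactor k 2 0) // gb0; lra.
rewrite Rmult_1_r; apply: le_exp.
have := ln_ge0 zp; rewrite ln_mult //; last lra.
by nra.
Qed.

(* Rankin's trick: [n <= N] gives [1/n <= e n^(-1-u)] for [u = 1 / ell N]. *)
Lemma tau_log_mean k : 0 < k -> exists2 C, 0 < C & forall N, (0 < N)%N ->
  \sum_(1 <= n < N.+1) (tau k n / INR n) <= C * Rpower (ell N) k.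
Proof.
move=> k0; exists (exp 1 * Rpower 2 k).
  by apply: Rmult_lt_0_compat; apply: exp_pos.
move=> N N0; have l1 := ell_ge1 N.
have u0 : 0 < / ell N by apply: Rinv_0_lt_compat; lra.
apply: (Rle_trans _ (exp 1 * Rpower (1 + ell N) k)); last first.
  rewrite Rmult_assoc Rpower_mult_distr; try lra.
  apply: Rmult_le_compat_l; first exact/Rlt_le/exp_pos.
  by apply: Rle_Rpower_l; lra.
have := tau_dirichlet_le N k0 u0; rewrite Rinv_inv => H.
apply: Rle_trans (Rmult_le_compat_l _ _ _ (Rlt_le _ _ (exp_pos 1)) H).
rewrite big_distrr /=; apply: le_sum => n /andP[n0]; rewrite ltnS => nN _.
have n0' := INR_gt0 n0.
rewrite -Rmult_assoc (Rmult_comm (exp 1)) Rmult_assoc.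
apply: Rmult_le_compat_l; first exact: tau_ge0.
rewrite -[X in / X](exp_ln _ n0') -exp_Ropp /Rpower -exp_plus; apply: le_exp.
have ln_n : ln (INR n) <= ell N.
  by have := le_ln n0' (INR_le nN); rewrite /ell; lra.
have := Rmult_le_compat_l (/ ell N) _ _ (Rlt_le _ _ u0) ln_n.
by rewrite Rinv_l; [lra | lra].
Qed.

(** * Logarithmic sums over primes and prime powers *)

Lemma ln_sum_logn n M : (0 < n <= M)%N ->
  ln (INR n) = \sum_(1 <= p < M.+1 | prime p) (INR (logn p n) * ln (INR p)).
Proof.
elim/ltn_ind: n => n IH /andP[n0 nM].
case: (ltnP 1 n) => [n1|n1]; last first.
  have -> : n = 1%N by lia.
  rewrite ln_1 big1 // => p _; rewrite logn1 (_ : INR 0 = 0) //; ring.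
set p := pdiv n; have pp : prime p := pdiv_prime n1.
have [e ne] := dvdnP (pdiv_dvd n); rewrite -/p mulnC in ne.
have p1 := prime_gt1 pp; have p0 := prime_gt0 pp.
have e0 : (0 < e)%N by lia.
have en : (e < n)%N by nia.
rewrite {1}ne INR_mul ln_mult; try exact: INR_gt0.
rewrite (IH e en) ?e0 ?(leq_trans (ltnW en)) //.
have -> : ln (INR p) =
    \sum_(1 <= q < M.+1 | prime q) (if q == p then ln (INR p) else 0).
  rewrite -big_mkcondr big_nat1_cond_eq p0 ltnS pp.
  by rewrite (leq_trans (pdiv_leq n0) nM).
rewrite -big_split; apply: eq_bigr => q qp /=.
rewrite ne lognM // (logn_prime _ pp) plus_INR.
case: eqP => [->|_].
  by rewrite (_ : INR true = 1) //; ring.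
by rewrite (_ : INR false = 0) //; ring.
Qed.

(* From [log Y! = sum_p log p sum_(n <= Y) v_p(n)] and [floor(Y/p) >= Y/(2p)]. *)
Lemma sum_ln_div_prime Y : (0 < Y)%N ->
  \sum_(1 <= p < Y.+1 | prime p) (ln (INR p) / INR p) <= 2 * ln (INR Y).
Proof.
move=> Y0; have Yp := INR_gt0 Y0.
suff H : \sum_(1 <= p < Y.+1 | prime p) (ln (INR p) * INR (Y %/ p)) <=
   INR Y * ln (INR Y).
  apply: (Rmult_le_reg_l (INR Y)) => //.
  apply: (Rle_trans _ (2 * (INR Y * ln (INR Y)))); last lra.
  apply: Rle_trans (Rmult_le_compat_l 2 _ _ _ H); last lra.
  rewrite !big_distrr /=; apply: le_sum => p /andP[p0 pY] _.
  have l0 := ln_INR_ge0 p; have pp := INR_gt0 p0.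
  have h : INR Y <= INR p * (2 * INR (Y %/ p)).
    have -> : INR p * (2 * INR (Y %/ p)) = INR (p * (2 * (Y %/ p)))%N.
      by rewrite !INR_mul.
    apply: INR_le; have e := divn_eq Y p; have := ltn_pmod Y p0.
    have : (0 < Y %/ p)%N by rewrite divn_gt0.
    by move: (Y %/ p)%N (Y %% p)%N e => q r; nia.
  have : INR Y / INR p <= 2 * INR (Y %/ p).
    apply: (Rmult_le_reg_l (INR p)) => //.
    by have -> : INR p * (INR Y / INR p) = INR Y by field; lra.
  move=> /(Rmult_le_compat_l _ _ _ l0); rewrite /Rdiv; lra.
apply: (Rle_trans _ (\sum_(1 <= n < Y.+1) ln (INR n))); last first.
  apply: (Rle_trans _ (\sum_(1 <= n < Y.+1) ln (INR Y))).
    apply: le_sum => n /andP[n0]; rewrite ltnS => nY _.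
    by apply: le_ln; [exact: INR_gt0 | exact: INR_le].
  by rewrite sum_const count_predT size_iota subn1; apply: Rle_refl.
have -> : \sum_(1 <= n < Y.+1) ln (INR n) =
  \sum_(1 <= n < Y.+1) \sum_(1 <= p < Y.+1 | prime p) (INR (logn p n) * ln (INR p)).
  by apply: eq_big_nat => n; rewrite ltnS => nY; apply: ln_sum_logn.
rewrite exchange_big_nat; apply: le_sum => p /andP[p0 _] pp.
rewrite -big_distrl /= Rmult_comm; apply: Rmult_le_compat_r; first exact: ln_INR_ge0.
have -> : INR (Y %/ p) = \sum_(1 <= n < Y.+1 | (p %| n)%N && true) 1.
  by rewrite (@big_multiples _ _ _ p) // sum_const count_predT size_iota subn1 Rmult_1_r.
rewrite big_mkcond; apply: le_sum => n /andP[n0 _] _.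
rewrite andbT; case: ifP => [pn|_]; last exact: pos_INR.
by apply: INR_ge1; rewrite logn_gt0 mem_primes pp n0.
Qed.

(** Both [gb k v] and v log p are O(p^(v/24)), the former by one term of the binomial series at
    2^(-1/24). As -3/4 + 1/24 + 1/24 = -2/3, each term is O(p^(-2v/3)); summing over v >= 2 leaves
    O(p^(-4/3)), and [zeta_partial_le] applies with u = 1/3. *)
Lemma prime_power_sum k : 0 < k -> exists2 c, 0 < c & forall N,
  \sum_(1 <= p < N.+1 | prime p) \sum_(2 <= v < N.+1)
    (ln (INR p) * (INR v * gb k v * Rpower (INR (p ^ v)%N) (- (3 / 4)))) <= c.
Proof.
move=> k0.
have ln2 : 0 < ln 2 by rewrite -ln_1; apply: ln_increasing; lra.
pose r := Rpower 2 (- (1 / 24)).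
have r0 : 0 < r by apply: Rpower_gt0.
have r1 : r < 1 by rewrite -[X in _ < X]exp_0; apply: exp_increasing; nra.
pose C := Rpower (1 - r) (- k); have C0 : 0 < C by apply: Rpower_gt0.
have gb_le v : gb k v <= C * exp (INR v * ln 2 / 24).
  have rv : exp (INR v * ln 2 / 24) * r ^ v = 1.
    rewrite /r -Rpower_pow // Rpower_mult /Rpower -exp_plus.
    by rewrite -[RHS]exp_0; congr exp; field.
  have h : gb k v * r ^ v <= C.
    apply: Rle_trans (gb_series_le v.+1 k0 (conj (Rlt_le _ _ r0) r1)).
    rewrite big_nat_recr //= -[X in X <= _]Rplus_0_l.
    apply: Rplus_le_compat_r; apply: sum_ge0 => j _ _.
    by apply: Rmult_le_pos; [exact: gb_ge0 | apply: pow_le; lra].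
  have e0 := exp_pos (INR v * ln 2 / 24).
  apply: (Rmult_le_reg_r (r ^ v)); first exact: pow_lt.
  by rewrite Rmult_assoc rv; lra.
pose w := Rpower 2 (- (2 / 3)).
have w0 : 0 < w by apply: Rpower_gt0.
have w1 : w < 1 by rewrite -[X in _ < X]exp_0; apply: exp_increasing; nra.
exists (24 * C * / (1 - w) * (1 + / (1 / 3))).
  have i1 : 0 < / (1 - w) by apply: Rinv_0_lt_compat; lra.
  have i2 : 0 < / (1 / 3) by apply: Rinv_0_lt_compat; lra.
  by repeat apply: Rmult_lt_0_compat; lra.
move=> N.
have C24 : 0 <= 24 * C * / (1 - w).
  have i1 : 0 < / (1 - w) by apply: Rinv_0_lt_compat; lra.
  by left; repeat apply: Rmult_lt_0_compat; lra.
have u0 : 0 < 1 / 3 by lra.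
apply: Rle_trans (Rmult_le_compat_l _ _ _ C24 (zeta_partial_le N u0)).
apply: (Rle_trans _ (24 * C * / (1 - w) *
    \sum_(1 <= n < N.+1 | prime n) Rpower (INR n) (- (1 + 1 / 3)))); last first.
  apply: Rmult_le_compat_l => //; apply: le_sum_subpred => // n _ _.
  exact/Rlt_le/Rpower_gt0.
rewrite big_distrr /=; apply: le_sum => p /andP[p0 _] pp.
have p2 : 2 <= INR p by apply: (@INR_le 2); apply: prime_gt1.
have lp : ln 2 <= ln (INR p) by apply: le_ln; lra.
pose z := Rpower (INR p) (- (2 / 3)).
have z0 : 0 < z by apply: Rpower_gt0.
have zw : z <= w by apply: le_exp; nra.
apply: (Rle_trans _ (\sum_(2 <= v < N.+1) (24 * C * z ^ v))).
  apply: le_sum => v _ _.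
  have v0 := pos_INR v.
  set l := ln (INR p) in lp *; set t := INR v in v0 *.
  have -> : Rpower (INR (p ^ v)%N) (- (3 / 4)) = exp (- (3 / 4) * (t * l)).
    by rewrite INR_exp /Rpower ln_pow //; lra.
  have -> : z ^ v = exp (- (2 / 3) * (t * l)).
    by rewrite -Rpower_pow // Rpower_mult /Rpower; congr exp; rewrite -/l -/t; ring.
  have tl : t * l <= 24 * exp (t * l / 24).
    by have := exp_ineq1_le (t * l / 24); lra.
  have gl : gb k v <= C * exp (t * l / 24).
    apply: Rle_trans (gb_le v) _; apply: Rmult_le_compat_l; first lra.
    by apply: le_exp; rewrite -/t; have := Rmult_le_compat_l _ _ _ v0 lp; lra.
  have g0 := gb_ge0 v k0; have e0 := exp_pos (- (3 / 4) * (t * l)).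
  have tl0 : 0 <= t * l by apply: Rmult_le_pos; lra.
  have -> : l * (t * gb k v * exp (- (3 / 4) * (t * l))) =
     (t * l) * gb k v * exp (- (3 / 4) * (t * l)) by ring.
  have -> : 24 * C * exp (- (2 / 3) * (t * l)) =
    24 * exp (t * l / 24) * (C * exp (t * l / 24)) * exp (- (3 / 4) * (t * l)).
    have -> : - (2 / 3) * (t * l) = t * l / 24 + t * l / 24 + - (3 / 4) * (t * l) by field.
    by rewrite !exp_plus; ring.
  apply: Rmult_le_compat_r; first lra.
  by apply: Rmult_le_compat.
have -> : Rpower (INR p) (- (1 + 1 / 3)) = z ^ 2.
  by rewrite -Rpower_pow // Rpower_mult; congr Rpower; rewrite /INR; field.
have geo M : (1 - z) * \sum_(2 <= v < M.+2) z ^ v = z ^ 2 - z ^ M.+2.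
  elim: M => [|M IH]; first by rewrite big_geq //; ring.
  by rewrite big_nat_recr //= Rmult_plus_distr_l IH /=; ring.
case: N {p0} => [|N].
  by rewrite big_geq //; apply: Rmult_le_pos => //; apply: pow_le; lra.
rewrite -big_distrr /= (Rmult_assoc (24 * C)); apply: Rmult_le_compat_l; first lra.
apply: (Rmult_le_reg_l (1 - w)); first lra.
have -> : (1 - w) * (/ (1 - w) * (z * (z * 1))) = z ^ 2 by field; lra.
have := geo N; have := pow_lt z N.+2 z0.
have : 0 <= \sum_(2 <= v < N.+2) z ^ v.
  by apply: sum_ge0 => v _ _; apply: pow_le; lra.
rewrite -/(z ^ 2); move: (\sum_(2 <= v < N.+2) z ^ v) (z ^ N.+2) => s y s0 y0 e.
have : (1 - w) * s <= (1 - z) * s by nra.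
by rewrite /= in e *; lra.
Qed.

Lemma RtoC_sum m n (P : pred nat) (F : nat -> R) :
  RtoC (\sum_(m <= i < n | P i) F i) = \csum_(m <= i < n | P i) RtoC (F i).
Proof. exact: (big_morph RtoC RtoC_plus (erefl _)). Qed.

Lemma Cmod_scale (x : R) (z : C) : 0 <= x -> Cmod (RtoC x * z)%C = x * Cmod z.
Proof. by move=> x0; rewrite Cmod_mult Cmod_R Rabs_pos_eq. Qed.

(** * The inductive estimate *)

Section Estimates.

Variables (f : nat -> C) (k A C0 : R).
Hypotheses (k0 : 0 < k) (A0 : 0 < A) (C00 : 0 < C0).
Hypothesis fM : multiplicative f.
Hypothesis f_le : forall n, (0 < n)%N -> Cmod (f n) <= tau k n.

Let lnC (n : nat) : C := RtoC (ln (INR n)).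

Definition psi q := \csum_(1 <= p < q.+1 | prime p) (RtoC (ln (INR p)) * f p).

Hypothesis psi_le : forall q, (2 <= q)%N ->
  Cmod (psi q) <= C0 * INR q / Rpower (ln (INR q)) A.

(** This is S_D(N) of the outline. *)
Definition sieved_sum D N := \csum_(1 <= n < N.+1 | cop D n) f n.

Lemma f_prime_le p : prime p -> Cmod (f p) <= k.
Proof.
move=> pp; apply: Rle_trans (f_le (prime_gt0 pp)) _.
by rewrite -{1}(expn1 p) tau_pfactor // gb1; apply: Rle_refl.
Qed.

Lemma f_pfactor_le p v : prime p -> Cmod (f (p ^ v)%N) <= gb k v.
Proof.
move=> pp; have pv0 : (0 < p ^ v)%N by rewrite expn_gt0 prime_gt0.
by apply: Rle_trans (f_le pv0) _; rewrite tau_pfactor //; apply: Rle_refl.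
Qed.

(** Expand log n over primes, exchange the sums and write n = p^v m with p not dividing m, so that
    f(n) = f(p^v) f(m). Primes of [D] disappear because they divide no [n] in the sum. *)
Lemma sum_f_ln D N : all prime D ->
  \csum_(1 <= n < N.+1 | cop D n) (f n * lnC n) =
  \csum_(1 <= p < N.+1 | prime p && (p \notin D)) (lnC p *
    \csum_(0 <= v < N.+1) (RtoC (INR v) * f (p ^ v)%N * sieved_sum (p :: D) (N %/ p ^ v)%N)).
Proof.
move=> Dp.
transitivity (\csum_(1 <= n < N.+1 | cop D n)
   \csum_(1 <= p < N.+1 | prime p) (lnC p * (RtoC (INR (logn p n)) * f n))).
  rewrite big_nat_cond [RHS]big_nat_cond; apply: eq_bigr => n /andP[nN _].
  rewrite /lnC (@ln_sum_logn n N) // RtoC_sum big_distrr /=.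
  by apply: eq_bigr => p _; rewrite RtoC_mult; ring.
rewrite exchange_big_nat [RHS]big_mkcondr; apply: eq_bigr => p pp.
rewrite -big_distrr /=; case: ifPn => [pD|/negPn pD]; last first.
  rewrite big_nat_cond big1 ?Cmult_0_r // => n /andP[/andP[n0 _] /allP/(_ p pD) pn].
  by rewrite lognE pp n0 (negbTE pn) Cmult_0_l.
congr Cmult; rewrite (@big_sieve _ _ _ p) //; apply: eq_bigr => v _.
rewrite /sieved_sum big_distrr /= big_nat_cond [RHS]big_nat_cond.
apply: eq_bigr => m /andP[/andP[m0 _] /andP[pm _]].
have pv0 : (0 < p ^ v)%N by rewrite expn_gt0 prime_gt0.
rewrite multiplicative_pfactorM // (lognM p pv0 m0) (pfactorK v pp).
by rewrite (lognE p m) (negbTE pm) !andbF addn0 Cmult_assoc.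
Qed.

(** Partial summation: log(N/n) is the sum of log((j+1)/j) over n <= j < N, and log(1 + 1/j) <= 1/j.
    Only S_D(j) with j < N appears, so the induction hypothesis will apply. *)
Lemma abel_le D N :
  Cmod (\csum_(1 <= n < N.+1 | cop D n) (f n * (lnC N - lnC n))) <=
  \sum_(1 <= n < N) (Cmod (sieved_sum D n) / INR n).
Proof.
have -> : \csum_(1 <= n < N.+1 | cop D n) (f n * (lnC N - lnC n)) =
   \csum_(1 <= n < N) (sieved_sum D n * (lnC n.+1 - lnC n)).
  elim: N => [|N IH]; first by rewrite !big_geq.
  rewrite big_mkcond big_nat_recr //= -big_mkcond.
  rewrite (_ : (if _ then _ else _) = RtoC 0); last by case: ifP => // _; ring.
  rewrite (_ : Cplus _ (RtoC 0) = \csum_(1 <= n < N.+1 | cop D n)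
     (f n * (lnC N - lnC n) + f n * (lnC N.+1 - lnC N))); last first.
    by rewrite Cplus_0_r; apply: eq_bigr => n _; ring.
  rewrite big_split /= IH -big_distrl /= -/(sieved_sum D N).
  case: N {IH} => [|N]; first by rewrite /sieved_sum !big_geq // Cmult_0_l Cplus_0_l.
  by rewrite [RHS]big_nat_recr.
apply: Cmod_csum_le => n /andP[n0 _] _.
have np := INR_gt0 n0; have np1 := INR_gt0 (ltn0Sn n).
rewrite Cmult_comm /lnC -RtoC_minus Cmod_scale; last first.
  by have := le_ln np (INR_le (leqnSn n)); lra.
rewrite /Rdiv Rmult_comm; apply: Rmult_le_compat_l; first exact: Cmod_ge_0.
rewrite -ln_div //; apply: Rle_trans (ln_le_sub1 (Rdiv_lt_0_compat _ _ np1 np)) _.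
by right; rewrite S_INR; field; lra.
Qed.

(** * The contributions of prime powers, small primes and large primes *)

Section Induction.

Variables (b K : R) (D : seq nat) (N : nat).
Hypotheses (K0 : 0 < K) (Dp : all prime D) (N0 : (0 < N)%N).
Hypothesis IH : forall n E, (0 < n < N)%N -> all prime E ->
  Cmod (sieved_sum E n) <= K * 2 ^ size E * INR n * Rpower (ell n) b.

Let h : R := 2 ^ size D.
Let lb : R := Rpower (ell N) b.

Let h1 : 1 <= h.
Proof. by apply: pow_R1_Rle; lra. Qed.

Let lb0 : 0 < lb.
Proof. exact: Rpower_gt0. Qed.

(** With q = floor(N/p^v), slow variation costs (N/q)^(1/4), and q (N/q)^(1/4) = N (N/q)^(-3/4) <= N
    p^(-3v/4). The factor 2 comes from adding [p] to [D]. *)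
Lemma prime_powers_le (Cs c : R) : 0 < Cs ->
  (forall q, (0 < q <= N)%N ->
    Rpower (ell q) b <= Cs * Rpower (INR N / INR q) (1 / 4) * lb) ->
  \sum_(1 <= p < N.+1 | prime p) \sum_(2 <= v < N.+1)
    (ln (INR p) * (INR v * gb k v * Rpower (INR (p ^ v)%N) (- (3 / 4)))) <= c ->
  Cmod (\csum_(1 <= p < N.+1 | prime p && (p \notin D)) (lnC p *
    \csum_(2 <= v < N.+1) (RtoC (INR v) * f (p ^ v)%N * sieved_sum (p :: D) (N %/ p ^ v)%N)))
  <= 2 * K * h * Cs * INR N * lb * c.
Proof.
move=> Cs0 Hs Hc; have Np := INR_gt0 N0.
pose M := 2 * K * h * Cs * INR N * lb.
have M0 : 0 < M by rewrite /M; repeat apply: Rmult_lt_0_compat; lra.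
apply: Rle_trans (Rmult_le_compat_l M _ _ (Rlt_le _ _ M0) Hc).
apply: (Rle_trans _ (\sum_(1 <= p < N.+1 | prime p && (p \notin D))
   (M * \sum_(2 <= v < N.+1)
    (ln (INR p) * (INR v * gb k v * Rpower (INR (p ^ v)%N) (- (3 / 4))))))); last first.
  rewrite big_distrr /=; apply: le_sum_subpred => p _; first by case/andP.
  move=> _; apply: Rmult_le_pos; first lra.
  apply: sum_ge0 => v _ _; apply: Rmult_le_pos; first exact: ln_INR_ge0.
  apply: Rmult_le_pos; last exact/Rlt_le/Rpower_gt0.
  by apply: Rmult_le_pos; [exact: pos_INR | exact: gb_ge0].
apply: Cmod_csum_le => p _ /andP[pp pD].
rewrite Cmod_scale ?big_distrr /=; last exact: ln_INR_ge0.
apply: (Rle_trans _ (ln (INR p) * \sum_(2 <= v < N.+1)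
   (M * (INR v * gb k v * Rpower (INR (p ^ v)%N) (- (3 / 4)))))); last first.
  by rewrite big_distrr /=; right; apply: eq_bigr => v _; ring.
apply: Rmult_le_compat_l; first exact: ln_INR_ge0.
apply: Cmod_csum_le => v /andP[v2 _] _.
rewrite Cmod_mult Cmod_scale; last exact: pos_INR.
have -> : M * (INR v * gb k v * Rpower (INR (p ^ v)%N) (- (3 / 4))) =
  INR v * gb k v * (M * Rpower (INR (p ^ v)%N) (- (3 / 4))) by ring.
have v0 := pos_INR v.
apply: Rmult_le_compat; try exact: Cmod_ge_0.
- by apply: Rmult_le_pos => //; apply: Cmod_ge_0.
- by apply: Rmult_le_compat_l => //; apply: f_pfactor_le.
set P := (p ^ v)%N; have P1 : (1 < P)%N.
  by apply: leq_trans (ltn_expl v (prime_gt1 pp)); lia.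
have Pp : 0 < INR P by apply: INR_gt0; lia.
set q := (N %/ P)%N; have Rp := Rpower_gt0 (INR P) (- (3 / 4)).
case: (posnP q) => [->|q0]; first by rewrite /sieved_sum big_geq // Cmod_0; nra.
have qp := INR_gt0 q0.
have qN : (q < N)%N by apply: ltn_Pdiv.
have qPN : INR q * INR P <= INR N by rewrite -INR_mul; apply: INR_le; apply: leq_divM.
apply: Rle_trans (IH _ _) _; rewrite ?q0 //=; first by rewrite pp.
apply: (Rle_trans _ (K * (2 * 2 ^ size D) * INR q *
  (Cs * Rpower (INR N / INR q) (1 / 4) * lb))).
  apply: Rmult_le_compat_l; last by apply: Hs; rewrite q0 ltnW.
  by rewrite -/h; repeat apply: Rmult_le_pos; lra.
have e : INR q * Rpower (INR N / INR q) (1 / 4) =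
    INR N * Rpower (INR N / INR q) (- (3 / 4)).
  have x0 : 0 < INR N / INR q by apply: Rdiv_lt_0_compat.
  have -> : 1 / 4 = 1 + - (3 / 4) by field.
  by rewrite Rpower_plus Rpower_1 //; field; lra.
have le : Rpower (INR N / INR q) (- (3 / 4)) <= Rpower (INR P) (- (3 / 4)).
  apply: le_exp; suff : ln (INR P) <= ln (INR N / INR q) by lra.
  apply: le_ln => //; apply: (Rmult_le_reg_l (INR q)) => //.
  by have -> : INR q * (INR N / INR q) = INR N by field; lra.
rewrite -/h.
have -> : K * (2 * h) * INR q * (Cs * Rpower (INR N / INR q) (1 / 4) * lb) =
   2 * K * h * Cs * lb * (INR q * Rpower (INR N / INR q) (1 / 4)) by ring.
rewrite e.
have -> : 2 * K * h * Cs * lb * (INR N * Rpower (INR N / INR q) (- (3 / 4))) =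
  M * Rpower (INR N / INR q) (- (3 / 4)) by rewrite /M; ring.
by apply: Rmult_le_compat_l; lra.
Qed.

Lemma ell_div_prime_le p : (0 < p)%N -> (p * p <= N)%N -> ell N <= 2 * ell (N %/ p).
Proof.
move=> p0 ppN; set q := (N %/ p)%N.
have pq : (p <= q)%N by rewrite leq_divRL.
(* N < p (q + 1) with p <= q. Then log 2 <= 1 gives [ell N <= 2 * ell q]. *)
have Nq : (N <= 2 * (q * q))%N.
  have := divn_eq N p; have := ltn_pmod N p0; rewrite -/q.
  by move: (N %% p)%N => r; nia.
have q0 : (0 < q)%N by lia.
have Np := INR_gt0 N0; have qp := INR_gt0 q0.
have := le_ln Np (INR_le Nq); rewrite !INR_mul ln_mult; try nra; last first.
  by rewrite (_ : INR 2 = 2) //; lra.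
rewrite ln_mult // (_ : INR 2 = 2) //.
have := @ln_le_sub1 2; rewrite /ell; lra.
Qed.

(** For p <= Y the logarithms of N and N/p are comparable within 2, whence 2^|b|, and the sum of
    (log p)/p is at most 2 log Y. This 2 and the one from enlarging [D] make the 4. *)
Lemma small_primes_le Y : (0 < Y)%N -> (Y * Y <= N)%N ->
  Cmod (\csum_(1 <= p < Y.+1 | prime p && (p \notin D))
     (lnC p * (f p * sieved_sum (p :: D) (N %/ p)%N)))
  <= 4 * K * h * k * Rpower 2 (Rabs b) * INR N * lb * ln (INR Y).
Proof.
move=> Y0 YN; have Np := INR_gt0 N0.
pose M := 2 * K * h * k * Rpower 2 (Rabs b) * INR N * lb.
have M0 : 0 < M.
  have R0 := Rpower_gt0 2 (Rabs b).
  by rewrite /M; repeat apply: Rmult_lt_0_compat; lra.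
have -> : 4 * K * h * k * Rpower 2 (Rabs b) * INR N * lb * ln (INR Y) =
  M * (2 * ln (INR Y)) by rewrite /M; ring.
apply: Rle_trans (Rmult_le_compat_l M _ _ (Rlt_le _ _ M0) (sum_ln_div_prime Y0)).
apply: (Rle_trans _ (\sum_(1 <= p < Y.+1 | prime p && (p \notin D))
   (M * (ln (INR p) / INR p)))); last first.
  rewrite big_distrr /=; apply: le_sum_subpred => p /andP[p0 _]; first by case/andP.
  move=> _; apply: Rmult_le_pos; first lra.
  by apply: Rdiv_le_0_compat; [exact: ln_INR_ge0 | exact: INR_gt0].
apply: Cmod_csum_le => p /andP[p0]; rewrite ltnS => pY /andP[pp pD].
rewrite Cmod_scale; last exact: ln_INR_ge0.
have -> : M * (ln (INR p) / INR p) = ln (INR p) * (k * (M / k / INR p)).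
  by have Pp := INR_gt0 p0; field; lra.
apply: Rmult_le_compat_l; first exact: ln_INR_ge0.
rewrite Cmod_mult; apply: Rmult_le_compat; try exact: Cmod_ge_0.
  exact: f_prime_le.
have ppN : (p * p <= N)%N by apply: leq_trans (leq_mul pY pY) YN.
set q := (N %/ p)%N.
have q0 : (0 < q)%N by rewrite divn_gt0 //; nia.
have qN : (q < N)%N by apply: ltn_Pdiv => //; exact: prime_gt1.
have Pp := INR_gt0 p0; have qp := INR_gt0 q0.
have qpN : INR q * INR p <= INR N by rewrite -INR_mul; apply: INR_le; apply: leq_divM.
apply: Rle_trans (IH _ _) _; rewrite ?q0 //=; first by rewrite pp.
have lq := ell_ge1 q; have lN := ell_ge1 N.
have l2 : Rpower (ell q) b <= Rpower 2 (Rabs b) * lb.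
  apply: Rpower_compare; try lra; last exact: ell_div_prime_le.
  suff : ell q <= ell N by lra.
  by rewrite /ell; have := le_ln qp (INR_le (ltnW qN)); lra.
have qle : INR q <= INR N / INR p.
  apply: (Rmult_le_reg_r (INR p)) => //.
  by have -> : INR N / INR p * INR p = INR N by field; lra.
rewrite -/h.
have -> : M / k / INR p = K * (2 * h) * (INR N / INR p) * (Rpower 2 (Rabs b) * lb).
  by rewrite /M; field; lra.
have Kh : 0 <= K * (2 * h) by apply: Rmult_le_pos; lra.
apply: Rmult_le_compat => //; last exact: Rmult_le_compat_l.
  by apply: Rmult_le_pos; lra.
exact/Rlt_le/Rpower_gt0.
Qed.

(** Primes of [D] give at most |D| log N and those dividing [m] at most log m, so |D| + 1 <= 2^|D|
    suffices. This keeps the weight 2^|D| of the induction stable. *)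
Lemma bad_primes_le m : (0 < m <= N)%N ->
  \sum_(1 <= p < N.+1 | prime p && ((p \in D) || (p %| m)%N)) ln (INR p) <=
  h * ln (INR N).
Proof.
move=> /andP[m0 mN]; have lN := ln_INR_ge0 N.
have hD : INR (size D) + 1 <= h.
  rewrite /h; elim: (D) => [|p E IHE]; first by rewrite (_ : INR 0 = 0) //=; lra.
  rewrite -[size (p :: E)]/(size E).+1 S_INR /=.
  by have := pos_INR (size E); lra.
apply: (Rle_trans _ ((INR (size D) + 1) * ln (INR N))); last first.
  exact: Rmult_le_compat_r.
apply: (Rle_trans _ (\sum_(1 <= p < N.+1) ((if p \in D then ln (INR N) else 0) +
   (if prime p then INR (logn p m) * ln (INR p) else 0)))).
  rewrite big_mkcond; apply: le_sum => p /andP[p0]; rewrite ltnS => pN _.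
  have lp := ln_INR_ge0 p; have lpN := le_ln (INR_gt0 p0) (INR_le pN).
  have n0 := pos_INR (logn p m).
  case pp: (prime p) => /=; last by case: (p \in D); lra.
  case: (p \in D) => /=; first by nra.
  case: ifP => pm; last by nra.
  have : 1 <= INR (logn p m) by apply: INR_ge1; rewrite logn_gt0 mem_primes pp m0.
  by nra.
rewrite big_split /= -!big_mkcond /= -ln_sum_logn ?m0 // Rmult_plus_distr_r Rmult_1_l.
apply: Rplus_le_compat; last by apply: le_ln; [exact: INR_gt0 | exact: INR_le].
rewrite sum_const; apply: Rmult_le_compat_r => //; apply: INR_le.
rewrite -size_filter; apply: uniq_leq_size; first by rewrite filter_uniq ?iota_uniq.
by move=> p; rewrite mem_filter => /andP[].
Qed.

(** Write the sum as psi(N/m) - psi(Y) minus the bad primes. The two values of [psi] give 2 C0; the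
    bad primes cost k h log N, and Y <= N/m turns this into a multiple of N/m with a saving of 1/Y.
    If N/m is smaller than Y, the sum is empty. *)
Lemma good_primes_le Y m : (2 <= Y)%N -> (0 < m <= N)%N ->
  Cmod (\csum_(Y.+1 <= p < (N %/ m).+1 | prime p && ~~ ((p \in D) || (p %| m)%N))
     (lnC p * f p))
  <= INR N / INR m * (2 * C0 / Rpower (ln (INR Y)) A + k * h * ln (INR N) / INR Y).
Proof.
move=> Y2 /andP[m0 mN]; set q := (N %/ m)%N; set W := _ + _.
have lN := ln_INR_ge0 N; have mp := INR_gt0 m0; have Np := INR_gt0 N0.
have Y0 : (0 < Y)%N by lia.
have Yp := INR_gt0 Y0.
have RY := Rpower_gt0 (ln (INR Y)) A.
have iR := Rinv_0_lt_compat _ RY; have iY := Rinv_0_lt_compat _ Yp.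
have kh0 : 0 <= k * h * ln (INR N) by apply: Rmult_le_pos => //; apply: Rmult_le_pos; lra.
have W0 : 0 <= W.
  by apply: Rplus_le_le_0_compat; apply: Rmult_le_pos; lra.
have Nm0 : 0 < INR N / INR m by apply: Rdiv_lt_0_compat.
case: (leqP q Y) => [qY|Yq].
  by rewrite big_geq // Cmod_0; apply: Rmult_le_pos; lra.
have qNm : INR q <= INR N / INR m.
  apply: (Rmult_le_reg_r (INR m)) => //.
  have -> : INR N / INR m * INR m = INR N by field; lra.
  by rewrite -INR_mul; apply: INR_le; apply: leq_divM.
have YNm := Rle_trans _ _ _ (INR_le (ltnW Yq)) qNm.
have lY : 0 < ln (INR Y).
  rewrite -ln_1; apply: ln_increasing; first lra.
  by have := INR_le Y2; rewrite (_ : INR 2 = 2) //; lra.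
have psiY j : (Y <= j)%N -> INR j <= INR N / INR m ->
    Cmod (psi j) <= C0 * (INR N / INR m) * / Rpower (ln (INR Y)) A.
  move=> Yj jNm; apply: Rle_trans (psi_le (leq_trans Y2 Yj)) _.
  have lj : ln (INR Y) <= ln (INR j) by apply: le_ln => //; apply: INR_le.
  apply: Rmult_le_compat.
  - by apply: Rmult_le_pos; [lra | exact: pos_INR].
  - exact/Rlt_le/Rinv_0_lt_compat/Rpower_gt0.
  - by apply: Rmult_le_compat_l; lra.
  - by apply: Rinv_le_contravar => //; apply: Rle_Rpower_l; lra.
set good := \csum_(_ <= _ < _ | _) _.
set bad := \csum_(Y.+1 <= p < q.+1 | prime p && ((p \in D) || (p %| m)%N))
  (lnC p * f p).
have e : good = (psi q - psi Y - bad)%C.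
  have -> : psi q = (psi Y + (bad + good))%C; last by ring.
  rewrite /psi (@big_cat_nat _ _ _ Y.+1) //=; last by rewrite ltnS ltnW.
  by congr Cplus; rewrite (bigID (fun p => (p \in D) || (p %| m)%N)).
have badle : Cmod bad <= k * h * ln (INR N).
  apply: (Rle_trans _ (\sum_(1 <= p < N.+1 |
     prime p && ((p \in D) || (p %| m)%N)) (k * ln (INR p)))); last first.
    rewrite -big_distrr /= Rmult_assoc; apply: Rmult_le_compat_l; first lra.
    by apply: bad_primes_le; rewrite m0.
  apply: (Rle_trans _ (\sum_(Y.+1 <= p < q.+1 |
     prime p && ((p \in D) || (p %| m)%N)) (k * ln (INR p)))).
    apply: Cmod_csum_le => p _ /andP[pp _].
    rewrite Cmod_scale; last exact: ln_INR_ge0.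
    rewrite Rmult_comm; apply: Rmult_le_compat_r; first exact: ln_INR_ge0.
    exact: f_prime_le.
  have qN : (q <= N)%N by apply: leq_div.
  apply: le_sum_range => // p _ _.
  by apply: Rmult_le_pos; [lra | exact: ln_INR_ge0].
rewrite e; apply: Rle_trans (Cmod_triangle _ _) _; rewrite Cmod_opp.
apply: Rle_trans (Rplus_le_compat_r _ _ _ (Cmod_triangle _ _)) _; rewrite Cmod_opp.
have pq := psiY q (ltnW Yq) qNm; have pY := psiY Y (leqnn Y) YNm.
have bb : k * h * ln (INR N) <= INR N / INR m * (k * h * ln (INR N) / INR Y).
  have x1 : 1 <= INR N / INR m / INR Y by apply: Rdiv_ge1.
  have -> : INR N / INR m * (k * h * ln (INR N) / INR Y) =
    k * h * ln (INR N) * (INR N / INR m / INR Y) by field; lra.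
  by nra.
rewrite /W Rmult_plus_distr_l.
have -> : INR N / INR m * (2 * C0 / Rpower (ln (INR Y)) A) =
  2 * (C0 * (INR N / INR m) * / Rpower (ln (INR Y)) A) by field; lra.
by lra.
Qed.

(** Exchange the sums over pm <= N so that the prime sum is innermost and its cancellation can be
    used; f(m) is then bounded by tau_k(m). The induction hypothesis is not applied, so no [K]
    appears. *)
Lemma large_primes_le Y : (2 <= Y)%N ->
  Cmod (\csum_(Y.+1 <= p < N.+1 | prime p && (p \notin D))
     (lnC p * (f p * sieved_sum (p :: D) (N %/ p)%N)))
  <= INR N * (2 * C0 / Rpower (ln (INR Y)) A + k * h * ln (INR N) / INR Y) *
     \sum_(1 <= m < N.+1) (tau k m / INR m).
Proof.
move=> Y2; set W := _ + _.
have -> : \csum_(Y.+1 <= p < N.+1 | prime p && (p \notin D))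
     (lnC p * (f p * sieved_sum (p :: D) (N %/ p)%N)) =
  \csum_(1 <= m < N.+1 | cop D m) (f m *
    \csum_(Y.+1 <= p < (N %/ m).+1 | prime p && ~~ ((p \in D) || (p %| m)%N))
      (lnC p * f p)).
  transitivity (\csum_(Y.+1 <= p < N.+1 | prime p && (p \notin D))
    \csum_(1 <= m < N.+1 | cop (p :: D) m && (m < (N %/ p).+1)%N)
      (f m * (lnC p * f p))).
    apply: eq_bigr => p _; rewrite /sieved_sum (@big_nat_widen _ _ _ _ _ N.+1); last first.
      by rewrite ltnS leq_div.
    by rewrite Cmult_assoc Cmult_comm big_distrl.
  rewrite (@exchange_big_dep_nat _ _ _ _ _ _ _ _ _ (cop D)) /=; last first.
    by move=> p m _ _ _ /andP[/andP[]].
  rewrite big_nat_cond [RHS]big_nat_cond.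
  apply: eq_bigr => m /andP[/andP[m0 mN] Dm].
  rewrite -big_distrr /=; congr Cmult.
  rewrite [RHS](@big_nat_widen _ _ _ _ _ N.+1); last by rewrite ltnS leq_div.
  rewrite big_nat_cond [RHS]big_nat_cond; apply: eq_bigl => p.
  case: (boolP (Y < p < N.+1)%N) => //= /andP[Yp pN].
  have p0 : (0 < p)%N by lia.
  rewrite Dm andbT !ltnS !leq_divRL // (mulnC m) negb_or.
  by case: (prime p) => //=; case: (p \notin D); rewrite //= andbC.
have -> : INR N * W * \sum_(1 <= m < N.+1) (tau k m / INR m) =
  \sum_(1 <= m < N.+1) (tau k m * (INR N / INR m * W)).
  by rewrite big_distrr /=; apply: eq_bigr => m _; rewrite /Rdiv; ring.
have lN := ln_INR_ge0 N.
have W0 : 0 <= W.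
  have Y0 : (0 < Y)%N by lia.
  apply: Rplus_le_le_0_compat; apply: Rmult_le_pos; try lra.
  - exact/Rlt_le/Rinv_0_lt_compat/Rpower_gt0.
  - by apply: Rmult_le_pos => //; apply: Rmult_le_pos; lra.
  - exact/Rlt_le/Rinv_0_lt_compat/INR_gt0.
apply: (Rle_trans _ (\sum_(1 <= m < N.+1 | cop D m) (tau k m * (INR N / INR m * W)))).
  apply: Cmod_csum_le => m /andP[m0 mN] _.
  rewrite Cmod_mult; apply: Rmult_le_compat; try exact: Cmod_ge_0.
    exact: f_le.
  by apply: good_primes_le => //; rewrite m0.
apply: le_sum_subpred => // m /andP[m0 _] _; apply: Rmult_le_pos; first exact: tau_ge0.
apply: Rmult_le_pos => //; apply: Rdiv_le_0_compat; [exact: pos_INR | exact: INR_gt0].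
Qed.

End Induction.

Lemma sieved_sum_ln D N Y : all prime D -> (Y <= N)%N -> (0 < N)%N ->
  (lnC N * sieved_sum D N)%C =
  (\csum_(1 <= n < N.+1 | cop D n) (f n * (lnC N - lnC n)) +
   (\csum_(1 <= p < N.+1 | prime p && (p \notin D)) (lnC p *
      \csum_(2 <= v < N.+1)
        (RtoC (INR v) * f (p ^ v)%N * sieved_sum (p :: D) (N %/ p ^ v)%N)) +
    (\csum_(1 <= p < Y.+1 | prime p && (p \notin D))
       (lnC p * (f p * sieved_sum (p :: D) (N %/ p)%N)) +
     \csum_(Y.+1 <= p < N.+1 | prime p && (p \notin D))
       (lnC p * (f p * sieved_sum (p :: D) (N %/ p)%N)))))%C.
Proof.
move=> Dp YN N0.
have -> : (lnC N * sieved_sum D N)%C =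
   (\csum_(1 <= n < N.+1 | cop D n) (f n * (lnC N - lnC n)) +
    \csum_(1 <= n < N.+1 | cop D n) (f n * lnC n))%C.
  by rewrite -big_split /sieved_sum big_distrr /=; apply: eq_bigr => n _; ring.
congr Cplus; rewrite sum_f_ln //.
have -> : (\csum_(1 <= p < Y.+1 | prime p && (p \notin D))
       (lnC p * (f p * sieved_sum (p :: D) (N %/ p)%N)) +
     \csum_(Y.+1 <= p < N.+1 | prime p && (p \notin D))
       (lnC p * (f p * sieved_sum (p :: D) (N %/ p)%N)))%C =
   \csum_(1 <= p < N.+1 | prime p && (p \notin D))
       (lnC p * (f p * sieved_sum (p :: D) (N %/ p)%N)).
  by rewrite [RHS](@big_cat_nat _ _ _ Y.+1).
rewrite -big_split; apply: eq_bigr => p _ /=.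
(* The term v = 0 vanishes and v = 1 is detached. *)
rewrite big_ltn // big_ltn // (_ : INR 0 = 0) // (_ : INR 1 = 1) // !expn1 /=.
by move: (\csum_(_ <= _ < _) _) => X; ring.
Qed.

(** The trivial bound, from 1 <= N/n; it covers bounded [N] in the induction. *)
Lemma sieved_sum_le D N CT : (0 < N)%N ->
  \sum_(1 <= n < N.+1) (tau k n / INR n) <= CT -> Cmod (sieved_sum D N) <= INR N * CT.
Proof.
move=> N0 H; apply: Rle_trans (Rmult_le_compat_l _ _ _ (pos_INR N) H).
rewrite big_distrr /=.
apply: (Rle_trans _ (\sum_(1 <= n < N.+1 | cop D n) (INR N * (tau k n / INR n)))).
  apply: Cmod_csum_le => n /andP[n0]; rewrite ltnS => nN _.
  apply: Rle_trans (f_le n0) _; have t0 := tau_ge0 k0 n0.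
  have x1 := Rdiv_ge1 (INR_gt0 n0) (INR_le nN).
  have -> : INR N * (tau k n / INR n) = tau k n * (INR N / INR n) by rewrite /Rdiv; ring.
  by nra.
apply: le_sum_subpred => // n /andP[n0 _] _.
apply: Rmult_le_pos; first exact: pos_INR.
by apply: Rdiv_le_0_compat; [exact: tau_ge0 | exact: INR_gt0].
Qed.

End Estimates.

(** * Choice of the parameters and conclusion of the induction *)

Lemma exists_nat_root r N : (2 <= r)%N -> (2 ^ r <= N)%N -> exists Y,
  [/\ (2 <= Y)%N, (Y * Y <= N)%N, INR r * ln (INR Y) <= ln (INR N)
    & ln (INR N) <= 2 * INR r * ln (INR Y)].
Proof.
move=> r2 rN.
have exP : exists Y, (Y ^ r <= N)%N by exists 2%N.
have ub Y : (Y ^ r <= N)%N -> (Y <= N)%N.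
  move=> h; apply: leq_trans h; case: Y => // Y.
  by rewrite -{1}(expn1 Y.+1) leq_pexp2l //; lia.
(* [Y] is the integer part of N^(1/r). By maximality N < (Y + 1)^r, and Y + 1 <= Y^2 because Y >=
   2. *)
case: (ex_maxnP exP ub) => Y YN Ymax.
have Y2 : (2 <= Y)%N by apply: Ymax.
have Yp : 0 < INR Y by apply: INR_gt0; lia.
have N0 : (0 < N)%N by apply: leq_trans rN; rewrite expn_gt0.
have Np := INR_gt0 N0.
exists Y; split => //.
- by apply: leq_trans YN; rewrite mulnn leq_pexp2l //; lia.
- rewrite -ln_pow // -INR_exp; apply: le_ln; last exact: INR_le.
  by apply: INR_gt0; rewrite expn_gt0; lia.
- have : (N <= (Y * Y) ^ r)%N.
    apply: leq_trans (_ : Y.+1 ^ r <= _)%N.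
      by apply: ltnW; rewrite ltnNge; apply/negP => /Ymax; rewrite ltnn.
    by rewrite leq_exp2r; [nia | lia].
  move=> /INR_le /(le_ln Np); rewrite INR_exp ln_pow; last by rewrite INR_mul; nra.
  by rewrite INR_mul ln_mult //; lra.
Qed.

Lemma exists_INR_ge (x : R) : exists n, x <= INR n.
Proof. by have [n] := INR_unbounded x; exists n; lra. Qed.

Lemma sieved_sum_bound (k A C0 : R) : 0 < k -> 0 < A -> 0 < C0 ->
  exists2 K, 0 < K & forall f : nat -> C,
    multiplicative f ->
    (forall n, (0 < n)%N -> Cmod (f n) <= tau k n) ->
    (forall q, (2 <= q)%N -> Cmod (psi f q) <= C0 * INR q / Rpower (ln (INR q)) A) ->
    forall N D, (0 < N)%N -> all prime D ->
    Cmod (sieved_sum f D N) <= K * 2 ^ size D * INR N * Rpower (ell N) (k - 1 - A).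
Proof.
move=> k0 A0 C00; set b := k - 1 - A.
have [Cs Cs0 Hs] := ell_slowly_varying b.
have [c c0 Hc] := prime_power_sum k0.
have [CT CT0 HT] := tau_log_mean k0.
(* [a1] collects the partial summation and the prime powers; [a2] is the coefficient of log Y from
   the small primes. *)
pose a1 := 2 * Cs * (1 + c); pose a2 := 4 * k * Rpower 2 (Rabs b).
have R2 := Rpower_gt0 2 (Rabs b).
have a10 : 0 < a1 by apply: Rmult_lt_0_compat; lra.
have a20 : 0 < a2 by repeat apply: Rmult_lt_0_compat; lra.
(* Then a2 log Y <= (a2/r) log N <= (log N)/4. *)
have [r Hr] := exists_INR_ge (4 * a2 + 2).
have rp : 0 < INR r by lra.
have r2 : (2 <= r)%N by apply/leP/RIneq.INR_le; rewrite (_ : INR 2 = 2) //; lra.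
have r4 : 0 < 1 / (4 * INR r) by apply: Rdiv_lt_0_compat; lra.
have [C5 C50 H5] := Rpower_le_exp (A + 1) r4.
have R4 := Rpower_gt0 (4 * INR r) A.
pose C3 := 2 * C0 * CT * Rpower (4 * INR r) A + k * CT * C5.
have C30 : 0 < C3 by apply: Rplus_lt_0_compat; repeat apply: Rmult_lt_0_compat; lra.
(* Beyond this point log N is at least 1 and at least 4 a1. *)
have [N1 HN1] := exists_INR_ge (exp (4 * a1) + exp 1).
pose N0 := maxn N1 (2 ^ r).
have RN0 := Rpower_gt0 (ell N0) (A + 1).
(* The first term absorbs the large primes, whose constant [C3] is independent of [K]; the second
   settles all N <= N0 by the trivial bound. *)
pose K := 4 * C3 + CT * Rpower (ell N0) (A + 1).
have CR0 : 0 < CT * Rpower (ell N0) (A + 1) by apply: Rmult_lt_0_compat.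
have K0 : 0 < K by rewrite /K; lra.
exists K => // f fM f_le psi_le; elim/ltn_ind => N IHN D Np Dp.
have IH n E : (0 < n < N)%N -> all prime E ->
    Cmod (sieved_sum f E n) <= K * 2 ^ size E * INR n * Rpower (ell n) b.
  by move=> /andP[n0 nN] Ep; apply: IHN.
have h1 : 1 <= 2 ^ size D by apply: pow_R1_Rle; lra.
have lN := ell_ge1 N; have NR := INR_gt0 Np.
set h := 2 ^ size D in h1 *; set lb := Rpower (ell N) b.
have lb0 : 0 < lb by apply: Rpower_gt0.
have lk : Rpower (ell N) k = lb * Rpower (ell N) (A + 1).
  by rewrite -Rpower_plus; congr Rpower; rewrite /b; ring.
case: (leqP N N0) => [NN0|N0N].
  apply: Rle_trans (sieved_sum_le k0 f_le D Np (HT N Np)) _; rewrite lk.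
  have le : Rpower (ell N) (A + 1) <= Rpower (ell N0) (A + 1).
    apply: Rle_Rpower_l; first lra.
    by split; [lra | rewrite /ell; have := le_ln NR (INR_le NN0); lra].
  have -> : INR N * (CT * (lb * Rpower (ell N) (A + 1))) =
    INR N * lb * (CT * Rpower (ell N) (A + 1)) by ring.
  have -> : K * h * INR N * lb = INR N * lb * (K * h) by ring.
  apply: Rmult_le_compat_l; first by apply: Rmult_le_pos; lra.
  apply: (Rle_trans _ K); last by nra.
  by rewrite /K; have := Rmult_le_compat_l CT _ _ (Rlt_le _ _ CT0) le; lra.
have N1N : INR N1 <= INR N by apply: INR_le; apply: leq_trans (ltnW N0N); apply: leq_maxl.
have rN : (2 ^ r <= N)%N by apply: leq_trans (ltnW N0N); apply: leq_maxr.
set L := ln (INR N).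
have e1 := exp_pos 1; have ea1 := exp_pos (4 * a1).
have L1 : 1 <= L by rewrite -[X in X <= _](ln_exp 1); apply: le_ln; lra.
have La1 : 4 * a1 <= L by rewrite -[X in X <= _](ln_exp (4 * a1)); apply: le_ln; lra.
have lL : ell N <= 2 * L by rewrite /ell -/L; lra.
have [Y [Y2 YYN rY Yr]] := exists_nat_root r2 rN.
have Y0 : (0 < Y)%N by lia.
have Yp := INR_gt0 Y0.
have YN : (Y <= N)%N by nia.
have main : L * Cmod (sieved_sum f D N) <=
    K * h * Cs * lb * (2 * INR N) + (2 * K * h * Cs * INR N * lb * c +
    (4 * K * h * k * Rpower 2 (Rabs b) * INR N * lb * ln (INR Y) +
     INR N * (2 * C0 / Rpower (ln (INR Y)) A + k * h * L / INR Y) *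
       (CT * Rpower (ell N) k))).
  rewrite -Cmod_scale; last lra.
  rewrite (sieved_sum_ln fM Dp YN Np).
  apply: Rle_trans (Cmod_triangle _ _) (Rplus_le_compat _ _ _ _ _ _);
    last (apply: Rle_trans (Cmod_triangle _ _) (Rplus_le_compat _ _ _ _ _ _);
    last apply: Rle_trans (Cmod_triangle _ _) (Rplus_le_compat _ _ _ _ _ _)).
  - apply: Rle_trans (abel_le f D N) _.
    apply: Rle_trans (Rmult_le_compat_l _ _ _ _ (sum_Rpower_ratio N)); last first.
      by repeat apply: Rmult_le_pos; lra.
    rewrite big_distrr /=.
    apply: Rle_trans (le_sum_range (a := 1) (b := N) _ _ _); rewrite ?leqnSn //; last first.
      move=> n _ _; apply: Rmult_le_pos; last exact/Rlt_le/Rpower_gt0.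
      by repeat apply: Rmult_le_pos; lra.
    apply: le_sum => n /andP[n0 nN] _.
    have nR := INR_gt0 n0.
    apply: (Rle_trans _ (K * h * Rpower (ell n) b)).
      apply: (Rmult_le_reg_r (INR n)) => //.
      have -> : Cmod (sieved_sum f D n) / INR n * INR n = Cmod (sieved_sum f D n) by field; lra.
      apply: Rle_trans (IH n D _ Dp) _; first by rewrite n0.
      by right; rewrite -/h; ring.
    apply: (Rle_trans _ (K * h * (Cs * Rpower (INR N / INR n) (1 / 4) * lb))).
      apply: Rmult_le_compat_l; first by apply: Rmult_le_pos; lra.
      by apply: Hs; rewrite n0 ltnW.
    by right; ring.
  - exact: (prime_powers_le k0 f_le K0 Dp Np IH Cs0 (fun q => Hs q N) (Hc N)).
  - exact: (small_primes_le k0 f_le K0 Dp Np IH Y0 YYN).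
  - apply: Rle_trans (large_primes_le k0 A0 C00 f_le psi_le Dp Np Y2) _.
    apply: Rmult_le_compat_l; last exact: HT.
    apply: Rmult_le_pos; first lra.
    have RY := Rinv_0_lt_compat _ (Rpower_gt0 (ln (INR Y)) A).
    have iY := Rinv_0_lt_compat _ Yp.
    by rewrite -/h -/L; apply: Rplus_le_le_0_compat; repeat apply: Rmult_le_pos; lra.
have lY : ell N <= 4 * INR r * ln (INR Y) by rewrite -/L in Yr; lra.
have lY0 : 0 < ln (INR Y) by nra.
have RY := Rpower_gt0 (ln (INR Y)) A.
(* Since log Y is comparable to log N, the saving (log Y)^(-A) cancels all but one of the A + 1
   logarithms. *)
have i : 2 * C0 / Rpower (ln (INR Y)) A * (CT * Rpower (ell N) (A + 1)) <=
    2 * C0 * CT * Rpower (4 * INR r) A * ell N.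
  have e : Rpower (ell N) A <= Rpower (4 * INR r) A * Rpower (ln (INR Y)) A.
    by rewrite Rpower_mult_distr; [apply: Rle_Rpower_l; lra | lra | lra].
  rewrite Rpower_plus Rpower_1; last lra.
  apply: (Rmult_le_reg_r (Rpower (ln (INR Y)) A)) => //.
  have -> : 2 * C0 / Rpower (ln (INR Y)) A * (CT * (Rpower (ell N) A * ell N)) *
     Rpower (ln (INR Y)) A = 2 * C0 * CT * ell N * Rpower (ell N) A by field; lra.
  have -> : 2 * C0 * CT * Rpower (4 * INR r) A * ell N * Rpower (ln (INR Y)) A =
     2 * C0 * CT * ell N * (Rpower (4 * INR r) A * Rpower (ln (INR Y)) A) by ring.
  by apply: Rmult_le_compat_l => //; repeat apply: Rmult_le_pos; lra.
(* [Y] is at least exp(ell N/(4r)), which dominates every power of [ell N]. *)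
have ii : L / INR Y * Rpower (ell N) (A + 1) <= C5 * ell N.
  have e : Rpower (ell N) (A + 1) <= C5 * INR Y.
    apply: Rle_trans (H5 _ lN) _; apply: Rmult_le_compat_l; first lra.
    rewrite -[X in _ <= X](exp_ln _ Yp); apply: le_exp.
    apply: (Rmult_le_reg_l (4 * INR r)); first lra.
    by have -> : 4 * INR r * (1 / (4 * INR r) * ell N) = ell N by field; lra.
  apply: (Rle_trans _ (L / INR Y * (C5 * INR Y))).
    by apply: Rmult_le_compat_l => //; apply: Rdiv_le_0_compat; lra.
  have -> : L / INR Y * (C5 * INR Y) = C5 * L by field; lra.
  by apply: Rmult_le_compat_l; rewrite /ell -/L; lra.
have E3 : INR N * (2 * C0 / Rpower (ln (INR Y)) A + k * h * L / INR Y) *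
       (CT * Rpower (ell N) k) <= h * INR N * lb * (2 * C3 * L).
  rewrite lk; set t := Rpower (ell N) (A + 1) in i ii *.
  have -> : INR N * (2 * C0 / Rpower (ln (INR Y)) A + k * h * L / INR Y) *
     (CT * (lb * t)) = INR N * lb * (2 * C0 / Rpower (ln (INR Y)) A * (CT * t) +
       k * h * CT * (L / INR Y * t)) by field; lra.
  have -> : h * INR N * lb * (2 * C3 * L) = INR N * lb * (h * (C3 * (2 * L))) by ring.
  apply: Rmult_le_compat_l; first by apply: Rmult_le_pos; lra.
  apply: (Rle_trans _ (h * (C3 * ell N))); last first.
    by apply: Rmult_le_compat_l; [lra | apply: Rmult_le_compat_l; lra].
  have kh : 0 <= k * h * CT by repeat apply: Rmult_le_pos; lra.
  have := Rmult_le_compat_l _ _ _ kh ii.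
  have : 2 * C0 * CT * Rpower (4 * INR r) A * ell N <=
     h * (2 * C0 * CT * Rpower (4 * INR r) A * ell N).
    rewrite -[X in X <= _]Rmult_1_l; apply: Rmult_le_compat_r => //.
    by repeat apply: Rmult_le_pos; lra.
  rewrite /C3; nra.
have E2 : a2 * ln (INR Y) <= L / 4 by rewrite -/L in rY; nra.
apply: (Rmult_le_reg_l L); first lra.
apply: Rle_trans main _.
have hN0 : 0 <= h * INR N * lb by repeat apply: Rmult_le_pos; lra.
have -> : L * (K * h * INR N * lb) = h * INR N * lb * (K * L) by ring.
(* The three terms are at most KL/4, KL/4 and KL/2, which closes the induction. *)
apply: (Rle_trans _ (h * INR N * lb * (K * a1 + K * (a2 * ln (INR Y)) + 2 * C3 * L))).
  by rewrite /a1 /a2; lra.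
apply: Rmult_le_compat_l => //.
have KC : 4 * C3 <= K by rewrite /K; lra.
by nra.
Qed.

(** * Passage to real [x] and to the original definitions *)

Lemma sum_leE f x : sum_le f x = sieved_sum f [::] (floorN x).
Proof.
rewrite /sum_le /Cxsum fold_right_map_big List_seq_iota.
by rewrite /sieved_sum /index_iota subn1.
Qed.

Lemma floorN_INR q : floorN (INR q) = q.
Proof. by rewrite /floorN Int_part_INR Znat.Nat2Z.id. Qed.

Lemma prime_sum_logE f q : prime_sum_log f (INR q) = psi f q.
Proof.
rewrite /prime_sum_log /Cxsum floorN_INR fold_right_map_big List_seq_iota.
rewrite /psi /index_iota subn1 [RHS]big_mkcond; apply: eq_bigr => p _.
rewrite is_primebE; case: prime => //.
by rewrite /Cxscale /Cmult /=; congr pair; ring.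
Qed.

Lemma floorN_bounds x : 2 <= x ->
  (2 <= floorN x)%N /\ INR (floorN x) <= x < INR (floorN x) + 1.
Proof.
move=> x2; have [h1 h2] := base_Int_part x.
have z2 : (2 <= Int_part x)%Z.
  suff : (1 < Int_part x)%Z by lia.
  by apply: lt_IZR; lra.
have e : INR (floorN x) = IZR (Int_part x).
  by rewrite /floorN INR_IZR_INZ Znat.Z2Nat.id //; lia.
by split; [rewrite /floorN; lia | rewrite e; lra].
Qed.

(** For x >= 2 one has log x >= 1/2, so 1 + log x <= 3 log x; conversely x <= 2 floor(x) gives log x
    <= 1 + log floor(x). *)
Lemma ell_floorN_le (b x : R) : 2 <= x ->
  Rpower (ell (floorN x)) b <= Rpower 3 (Rabs b) * Rpower (ln x) b.
Proof.
move=> x2; have [N2 [Nx xN]] := floorN_bounds x2.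
have Np : 0 < INR (floorN x) by apply: INR_gt0; lia.
have lx : 1 / 2 <= ln x.
  apply: Rle_trans (le_ln _ x2); last lra.
  have := @ln_le_sub1 (/ 2); rewrite ln_Rinv; lra.
have l1 := ell_ge1 (floorN x).
apply: Rpower_compare; try lra; first by have := le_ln Np Nx; rewrite /ell; lra.
have x0 : 0 < x by lra.
have x2N : x <= 2 * INR (floorN x).
  by have := INR_le N2; rewrite (_ : INR 2 = 2) //; lra.
have := le_ln x0 x2N; rewrite ln_mult //; last lra.
by have := @ln_le_sub1 2; rewrite /ell in l1 *; lra.
Qed.

End PartialSums.

Theorem theorem4p1 :
  forall (k A C0 : R), 0 < k -> 0 < A -> 0 < C0 ->
  exists C : R,
    forall f : nat -> Cx,
      multiplicative f ->
      (forall n : nat, (1 <= n)%nat -> Cxnorm (f n) <= tau k n) ->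
      (forall x : R, 2 <= x -> Cxnorm (prime_sum_log f x) <= C0 * x / Rpower (ln x) A) ->
      forall x : R, 2 <= x -> Cxnorm (sum_le f x) <= C * x * Rpower (ln x) (k - 1 - A).
Proof.
  intros k A C0 k0 A0 C00.
  destruct (PartialSums.sieved_sum_bound k0 A0 C00) as [K K0 HK].
  (* The estimate is used with [D] empty; the power of 3 pays for replacing [ell (floorN x)] by
     [ln x]. *)
  exists (K * Rpower 3 (Rabs (k - 1 - A))).
  intros f fM f_le f_primes x x2.
  destruct (PartialSums.floorN_bounds x2) as [N2 [Nx _]].
  rewrite PartialSums.sum_leE.
  eapply Rle_trans.
  - apply (HK f fM).
    + intros n n0. apply f_le. exact (ssrbool.elimT ssrnat.leP n0).
    + intros q q2. rewrite <- PartialSums.prime_sum_logE. apply f_primes.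
      exact (le_INR 2 q (ssrbool.elimT ssrnat.leP q2)).
    + exact (ssrnat.ltnW N2).
    + reflexivity.
  - cbn [Datatypes.length seq.size pow].
    rewrite Rmult_1_r.
    rewrite !Rmult_assoc, (Rmult_comm (Rpower 3 _)), Rmult_assoc.
    apply Rmult_le_compat_l; [lra |].
    rewrite (Rmult_comm (Rpower (ln x) _)).
    apply Rmult_le_compat.
    + apply pos_INR.
    + left. apply exp_pos.
    + exact Nx.
    + exact (PartialSums.ell_floorN_le _ x2).
Qed.
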